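(* Let $A\in\mathbb{R}^{d\times d}$ with $\rho(A)<1$, and consider $x_0=0$, $x_{s+1}=Ax_s+\eta_{s+1}$, where $(\eta_s)_{s\ge1}$ are i.i.d. zero-mean isotropic random vectors in $\mathbb{R}^d$ with independent coordinates of $\psi_2$-norm at most $K$. Fix $t\ge1$, let $X\in\mathbb{R}^{t\times d}$ be the matrix with $X^\top=(x_1,\dots,x_t)$, and let $M=\big(\sum_{s=0}^{t-1}\Gamma_s(A)\big)^{-1/2}$. Let $\varepsilon>0$. Then $$\frac{1}{\|M\|}(1-K^2\varepsilon)\le s_d(X)\le\dots\le s_1(X)\le(1+K^2\varepsilon)\frac{1}{s_d(M)}$$ holds with probability at least $$1-2\exp\Big(-c_1\varepsilon^2\frac{1}{\|M\|^2\|\Gamma\|^2}+c_2 d\Big),$$ for some universal constants $c_1,c_2>0$.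
   Context: $s_1(W)\ge\dots\ge s_d(W)$ denote the singular values of a matrix $W$ with at least $d$ rows, in non-increasing order. $\|\cdot\|$ is the operator norm. $\Gamma_s(A)=\sum_{k=0}^{s}A^k(A^k)^\top$. $\Gamma$ is the $td\times td$ block lower-triangular Toeplitz matrix whose $(i,j)$ block ($1\le i,j\le t$) equals $A^{i-j}$ if $i\ge j$ and $0$ otherwise. The $\psi_2$-norm of a real random variable $Y$ is $\inf\{K\ge0:\mathbb{E}\exp(Y^2/K^2)\le2\}$; isotropic means $\mathbb{E}\eta\eta^\top=I_d$. *)

(* Defs.v *)
From HB Require Import structures.
From mathcomp Require Import all_boot all_order all_algebra.
From mathcomp Require Import all_classical all_reals all_analysis.
From mathcomp Require Import complex.
Set Implicit Arguments. Unset Strict Implicit. Unset Printing Implicit Defensive.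
Import Order.TTheory GRing.Theory Num.Theory.
Local Open Scope classical_set_scope.
Local Open Scope ring_scope.

Section Defs.
Variable R : realType.

Definition spectral_radius (d : nat) (A : 'M[R]_d) : R :=
  sup [set r : R | exists z : R[i],
        root (char_poly (map_mx (fun x : R => (x%:C)%C) A)) z /\ (r%:C)%C = `|z| ].

Definition enorm (n : nat) (v : 'cV[R]_n) : R := Num.sqrt (\sum_i v i 0 ^+ 2).

Definition opnorm (m n : nat) (B : 'M[R]_(m, n)) : R :=
  sup [set enorm (B *m v) | v in [set v : 'cV[R]_n | enorm v <= 1]].

(** [sv_seq W s]: s is the non-increasing sequence (s_1(W), ..., s_n(W)) of
    singular values of W, i.e. the nonnegative square roots of the
    eigenvalues (with multiplicity) of W^T W. *)
Definition sv_seq (m n : nat) (W : 'M[R]_(m, n)) (s : seq R) : Prop :=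
  [/\ size s = n, sorted (fun a b => b <= a) s, all (fun a => 0 <= a) s &
      char_poly (W^T *m W) = \prod_(a <- s) ('X - (a ^+ 2)%:P)].

Definition Gram_s (d : nat) (A : 'M[R]_d) (s : nat) : 'M[R]_d :=
  \sum_(k < s.+1) (A ^+ k *m (A ^+ k)^T).

Definition bigGamma (d t : nat) (A : 'M[R]_d) :=
  \mxblock_(i < t, j < t)
     (if (j <= i)%N then A ^+ (i - j) else (0 : 'M[R]_d)).

Definition inv_sqrt_of (d : nat) (S M : 'M[R]_d) : Prop :=
  [/\ M^T = M,
      (forall v : 'cV[R]_d, v != 0 -> 0 < (v^T *m M *m v) 0 0) &
      M *m M *m S = 1%:M].

Fixpoint traj (T : Type) (d : nat) (A : 'M[R]_d) (eta : nat -> 'I_d -> T -> R)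
    (w : T) (s : nat) : 'cV[R]_d :=
  match s with
  | 0 => 0
  | s'.+1 => A *m traj A eta w s' + \col_i eta s'.+1 i w
  end.

Definition data_matrix (T : Type) (d t : nat) (A : 'M[R]_d)
    (eta : nat -> 'I_d -> T -> R) (w : T) : 'M[R]_(t, d) :=
  \matrix_(i < t, j < d) traj A eta w i.+1 j 0.

End Defs.

Section Prob.
Local Open Scope ereal_scope.
Variables (dsp : measure_display) (T : measurableType dsp) (R : realType)
          (P : probability T R).

Definition psi2norm (Y : T -> R) : \bar R :=
  ereal_inf [set k%:E | k in [set k : R | (0 < k)%R /\
      \int[P]_w (expR (Y w ^+ 2 / k ^+ 2))%:E <= 2%:E]].

Definition mutually_independent (idx : eqType) (I : set idx)
    (F : idx -> set_system T) : Prop :=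
  forall (J : seq idx) (E : idx -> set T), uniq J ->
    (forall j, j \in J -> I j /\ F j (E j)) ->
    P (\bigcap_(j in [set` J]) E j) = \prod_(j <- J) P (E j).

Definition sigmaRV (Y : T -> R) : set_system T :=
  preimage_set_system setT Y measurable.

Definition sigmaRVec (d : nat) (Y : 'I_d -> T -> R) : set_system T :=
  <<s \bigcup_(i in setT) sigmaRV (Y i) >>.

Definition borelRd (d : nat) : set_system ('I_d -> R) :=
  <<s \bigcup_(i in setT)
        preimage_set_system setT (fun v : 'I_d -> R => v i) measurable >>.

Definition rvec (d : nat) (Y : 'I_d -> T -> R) : T -> ('I_d -> R) :=
  fun w i => Y i w.
End Prob.

(* Main.v *)
Require Import Defs.
From HB Require Import structures.
From mathcomp Require Import all_boot all_order all_algebra.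
From mathcomp Require Import all_classical all_reals all_analysis.
From mathcomp Require Import complex.
From mathcomp Require Import measurable_realfun.
From mathcomp Require Import ring lra.
Import Order.TTheory GRing.Theory Num.Theory.
Local Open Scope classical_set_scope.
Local Open Scope ring_scope.
Set Implicit Arguments. Unset Strict Implicit. Unset Printing Implicit Defensive.

(** Write [X M u = sum_p Y_p b_p], where the [Y_p] are the noise coordinates.
    The choice of [M] gives [sum_p |b_p|^2 = |u|^2], and the operator with
    columns [b_p] has norm at most [||M|| ||Gamma||] for unit [u], so the
    theorem follows from a Hanson-Wright inequality for
    [|sum_p Y_p b_p|^2 - sum_p |b_p|^2], a union bound over a net of the sphere
    and the observation that every singular value of [X] is attained on an
    eigenvector of [X^T X].

    Neither decoupling nor Gaussian comparison is needed for Hanson-Wright: in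
    [E exp (lam |W|^2)] the coordinates are integrated out one at a time.  With
    [W_n = sum_(j < n) Y_j b_j], integrating out [Y_n] bounds
    [E exp (W_(n+1)^T H_(n+1) W_(n+1))] by a constant times
    [E exp (W_n^T H_n W_n)] as soon as
    [H_n >= H_(n+1) + C L^2 H_(n+1) b_n b_n^T H_(n+1)].  By the
    Sherman-Morrison formula this holds for
    [H_n = lam (1 - k sum_(j >= n) b_j b_j^T)^-1] with [k] of order
    [L^2 lam], and these resolvents stay within a factor two of [lam] as long
    as [|lam|] is at most of order [1 / (L ||B||)^2], [B] being the operator
    with columns [b_j].  The same argument covers both signs of [lam]. *)

(** * Operator norm and resolvents *)

Section Dot.
Context {R : realType}.

Definition dot n (u v : 'cV[R]_n) : R := (u^T *m v) 0 0.

Lemma dotE n (u v : 'cV[R]_n) : dot u v = \sum_i u i 0 * v i 0.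
Proof. by rewrite /dot mxE; apply: eq_bigr => i _; rewrite mxE. Qed.

Lemma dotC n (u v : 'cV[R]_n) : dot u v = dot v u.
Proof. by rewrite !dotE; apply: eq_bigr => i _; rewrite mulrC. Qed.

Lemma dotDr n (u v w : 'cV[R]_n) : dot u (v + w) = dot u v + dot u w.
Proof. by rewrite /dot mulmxDr mxE. Qed.

Lemma dotDl n (u v w : 'cV[R]_n) : dot (u + v) w = dot u w + dot v w.
Proof. by rewrite dotC dotDr !(dotC w). Qed.

Lemma dotZr n a (u v : 'cV[R]_n) : dot u (a *: v) = a * dot u v.
Proof. by rewrite /dot -scalemxAr mxE. Qed.

Lemma dotZl n a (u v : 'cV[R]_n) : dot (a *: u) v = a * dot u v.
Proof. by rewrite dotC dotZr dotC. Qed.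

Lemma dotNr n (u v : 'cV[R]_n) : dot u (- v) = - dot u v.
Proof. by rewrite -scaleN1r dotZr mulN1r. Qed.

Lemma dotNl n (u v : 'cV[R]_n) : dot (- u) v = - dot u v.
Proof. by rewrite dotC dotNr dotC. Qed.

Lemma dot0r n (u : 'cV[R]_n) : dot u 0 = 0.
Proof. by rewrite /dot mulmx0 mxE. Qed.

Lemma dot0l n (u : 'cV[R]_n) : dot 0 u = 0.
Proof. by rewrite dotC dot0r. Qed.

Lemma dot_sumr n (I : Type) (r : seq I) (Q : pred I) (u : 'cV[R]_n) F :
  dot u (\sum_(i <- r | Q i) F i) = \sum_(i <- r | Q i) dot u (F i).
Proof. by rewrite /dot mulmx_sumr summxE. Qed.

Lemma dot_mulmxr m n (B : 'M[R]_(m, n)) u v :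
  dot u (B *m v) = dot (B^T *m u) v.
Proof. by rewrite /dot trmx_mul trmxK mulmxA. Qed.

Lemma dot_ge0 n (u : 'cV[R]_n) : 0 <= dot u u.
Proof. by rewrite dotE sumr_ge0// => i _; rewrite -expr2 sqr_ge0. Qed.

Lemma dot_eq0 n (u : 'cV[R]_n) : (dot u u == 0) = (u == 0).
Proof.
apply/eqP/eqP => [|->]; last exact: dot0r.
rewrite dotE => /psumr_eq0P h; apply/colP => i; rewrite mxE.
have /eqP := h (fun i _ => ltac:(by rewrite -expr2 sqr_ge0)) i isT.
by rewrite mulf_eq0 orbb => /eqP.
Qed.

Lemma dot_gt0 n (u : 'cV[R]_n) : (0 < dot u u) = (u != 0).
Proof. by rewrite lt_def dot_ge0 andbT dot_eq0. Qed.

Lemma cauchy_schwarz n (u v : 'cV[R]_n) : dot u v ^+ 2 <= dot u u * dot v v.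
Proof.
have [->|v0] := eqVneq v 0; first by rewrite !dot0r mulr0 expr2 mul0r.
have := dot_ge0 (dot v v *: u - dot u v *: v).
rewrite !(dotDr, dotDl, dotNr, dotNl, dotZl, dotZr) (dotC v u).
have v1 : 0 < dot v v by rewrite dot_gt0.
move=> h; rewrite -(ler_pM2l v1); lra.
Qed.

Lemma enorm_dot n (u : 'cV[R]_n) : enorm u = Num.sqrt (dot u u).
Proof. by rewrite /enorm dotE; congr Num.sqrt; apply: eq_bigr. Qed.

Lemma sqr_enorm n (u : 'cV[R]_n) : enorm u ^+ 2 = dot u u.
Proof. by rewrite enorm_dot sqr_sqrtr ?dot_ge0. Qed.

Lemma enorm_ge0 n (u : 'cV[R]_n) : 0 <= enorm u.
Proof. by rewrite enorm_dot sqrtr_ge0. Qed.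

(** Row-wise Cauchy-Schwarz gives the squared Frobenius norm. This crude constant only serves to
    show that suprema over the unit ball and the unit sphere are finite. *)
Lemma dot_mulmx_bounded m n (B : 'M[R]_(m, n)) :
  exists2 C, 0 <= C & forall v, dot (B *m v) (B *m v) <= C * dot v v.
Proof.
exists (\sum_i dot (row i B)^T (row i B)^T) => [|v].
  by apply: sumr_ge0 => i _; exact: dot_ge0.
rewrite [leLHS]dotE mulr_suml ler_sum// => i _.
have -> : (B *m v) i 0 = dot (row i B)^T v by rewrite /dot trmxK -row_mul [RHS]mxE.
by rewrite -expr2 cauchy_schwarz.
Qed.

Lemma opnorm_has_sup m n (B : 'M[R]_(m, n)) :
  has_sup [set enorm (B *m v) | v in [set v : 'cV[R]_n | enorm v <= 1]].
Proof.
split; first by exists (enorm (B *m 0)), 0 => //=; rewrite enorm_dot dot0r sqrtr0.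
have [C C0 hC] := dot_mulmx_bounded B; exists (Num.sqrt C) => _ [v /= v1 <-].
rewrite enorm_dot ler_wsqrtr// (le_trans (hC v))// ler_piMr//.
by rewrite -sqr_enorm expr_le1// enorm_ge0.
Qed.

Lemma opnorm_ge0 m n (B : 'M[R]_(m, n)) : 0 <= opnorm B.
Proof.
have [_ hu] := opnorm_has_sup B.
apply: (@le_trans _ _ (enorm (B *m 0))); first exact: enorm_ge0.
by apply: (ub_le_sup hu); exists 0 => //=; rewrite enorm_dot dot0r sqrtr0.
Qed.

Lemma enorm_mulmx m n (B : 'M[R]_(m, n)) v : enorm (B *m v) <= opnorm B * enorm v.
Proof.
have [->|v0] := eqVneq v 0.
  by rewrite mulmx0 !enorm_dot !dot0r sqrtr0 mulr0.
have e0 : 0 < enorm v by rewrite enorm_dot sqrtr_gt0 dot_gt0.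
rewrite -ler_pdivrMr//; have [_ hu] := opnorm_has_sup B.
apply: (ub_le_sup hu) => /=; exists ((enorm v)^-1 *: v) => /=.
  by rewrite enorm_dot dotZl dotZr -sqr_enorm mulrA -expr2 -exprMn mulVf ?gt_eqF//
    expr1n sqrtr1.
rewrite -scalemxAr enorm_dot dotZl dotZr mulrA -expr2 sqrtrM ?sqr_ge0//.
by rewrite sqrtr_sqr ger0_norm ?invr_ge0 ?ltW// -enorm_dot mulrC.
Qed.

Lemma dot_mulmx_le m n (B : 'M[R]_(m, n)) v :
  dot (B *m v) (B *m v) <= opnorm B ^+ 2 * dot v v.
Proof.
by rewrite -!sqr_enorm -exprMn lerXn2r ?nnegrE ?enorm_mulmx// ?enorm_ge0//
  mulr_ge0 ?opnorm_ge0 ?enorm_ge0.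
Qed.

(** Duality: for [w = B^T v] one has [|w|^2 = <v, B w>], so Cauchy-Schwarz gives
    [|w|^4 <= b |v|^2 |w|^2], and a factor [|w|^2] cancels. *)
Lemma dot_trmx_le m n (B : 'M[R]_(m, n)) b : 0 <= b ->
  (forall v, dot (B *m v) (B *m v) <= b * dot v v) ->
  forall v, dot (B^T *m v) (B^T *m v) <= b * dot v v.
Proof.
move=> b0 hB v; set w := B^T *m v.
have [w0|w0] := eqVneq w 0; first by rewrite w0 dot0r mulr_ge0 ?dot_ge0.
have w1 : 0 < dot w w by rewrite dot_gt0.
have e : dot w w = dot v (B *m w) by rewrite dot_mulmxr.
rewrite -(ler_pM2l w1) -expr2 {1}e (le_trans (cauchy_schwarz _ _))//.
have := ler_wpM2l (dot_ge0 v) (hB w); lra.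
Qed.

(** A nonzero kernel vector would make the quadratic form vanish. [kermx] is a left kernel, hence
    the transpose. *)
Lemma coercive_unitmx n (S : 'M[R]_n) c : 0 < c ->
  (forall y, c * dot y y <= dot y (S *m y)) -> S \in unitmx.
Proof.
move=> c0 hS; rewrite -unitmx_tr -row_free_unit; apply/row_freeP.
apply: contrapT => h; have : kermx S^T != 0.
  by rewrite kermx_eq0; apply/negP => /row_freeP.
case/rowV0Pn => v /sub_kermxP vS v0.
have := hS v^T; rewrite -[S *m _]trmxK trmx_mul trmxK vS trmx0 dot0r.
rewrite leNgt mulr_gt0// dot_gt0; apply: contra_neq v0 => v0.
by rewrite -[v]trmxK v0 trmx0.
Qed.

(** * Quadratic forms of inverses and rank-one updates *)

Section Resolvent.
Context n (S : 'M[R]_n).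
Hypothesis Ssym : S^T = S.
Hypothesis Scoer : forall y, 3 / 4 * dot y y <= dot y (S *m y).

Lemma resolvent_unitmx : S \in unitmx.
Proof. by apply: (coercive_unitmx _ Scoer); lra. Qed.

Lemma resolvent_sym x y : dot x (invmx S *m y) = dot y (invmx S *m x).
Proof. by rewrite dot_mulmxr trmx_inv Ssym dotC. Qed.

(** With [y = S^-1 x] and [p = <y, x>], coercivity gives [3/4 |y|^2 <= p] and Cauchy-Schwarz gives
    [p^2 <= |y|^2 |x|^2], so even [p <= 4/3 |x|^2]. *)
Lemma resolvent_dot_bounds x :
  0 <= dot x (invmx S *m x) /\ dot x (invmx S *m x) <= 2 * dot x x.
Proof.
set y := invmx S *m x.
have Sy : S *m y = x by rewrite /y mulKVmx ?resolvent_unitmx.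
have h := Scoer y; rewrite Sy in h.
have hy := dot_ge0 y; have hx := dot_ge0 x; have cs := cauchy_schwarz y x.
rewrite (dotC x y); set p := dot y x in h cs *; set q := dot y y in h cs hy.
set r := dot x x in cs hx *.
have p0 : 0 <= p by nra.
split=> //; rewrite leNgt; apply/negP => hp.
have : 0 <= r * (p - 3 / 4 * q) by rewrite mulr_ge0 ?subr_ge0.
clear Sy; clearbody p q r; nra.
Qed.

(** The equation [S' v = x] is solved by [v = y + alpha z], with [y = S^-1 x] and [z = S^-1 b]: the
    coefficient of [b] in [S' v - x] vanishes exactly when [alpha (1 - s) = k <b, y>]. *)
Lemma sherman_morrison k b (s := k * dot b (invmx S *m b))
    (S' := S - k *: (b *m b^T)) : S' \in unitmx -> s != 1 ->
  forall x, dot x (invmx S' *m x) =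
    dot x (invmx S *m x) + k / (1 - s) * dot b (invmx S *m x) ^+ 2.
Proof.
move=> uS' s1 x; set y := invmx S *m x; set z := invmx S *m b.
have Sy : S *m y = x by rewrite /y mulKVmx ?resolvent_unitmx.
have Sz : S *m z = b by rewrite /z mulKVmx ?resolvent_unitmx.
have bbE (v : 'cV_n) : (b *m b^T) *m v = dot b v *: b.
  by rewrite -mulmxA [b^T *m v]mx11_scalar mul_mx_scalar.
have s1' : 1 - s != 0 by rewrite subr_eq0 eq_sym.
have -> : invmx S' *m x = y + (k / (1 - s) * dot b y) *: z.
  apply: (canLR (mulKmx uS')).
  rewrite /S' mulmxBl !mulmxDr -!scalemxAr -!scalemxAl Sy Sz !bbE.
  rewrite !scalerA opprD addrACA -addrA -scalerBl -scaleNr -scalerDl.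
  rewrite [X in X *: _](_ : _ = 0) ?scale0r ?addr0//.
  by rewrite /s -/z in s1' *; field.
rewrite dotDr dotZr /z resolvent_sym -/y; ring.
Qed.

End Resolvent.


(** * Resolvents of small multiples of a positive semidefinite matrix *)

Section ResolventPerturbation.
Context n (Sig : 'M[R]_n) (k c : R).
Hypothesis Sigsym : Sig^T = Sig.
Hypothesis kc : `|k| * c <= 1 / 4.
Hypothesis Sig0 : forall y, 0 <= dot y (Sig *m y).
Hypothesis Sigc : forall y, dot y (Sig *m y) <= c * dot y y.
Hypothesis Sig2 : forall y, dot (Sig *m y) (Sig *m y) <= c * dot y (Sig *m y).
Let S := 1%:M - k *: Sig.

Lemma perturbation_sym : S^T = S.
Proof. by rewrite /S linearB /= trmx1 linearZ /= Sigsym. Qed.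

Lemma perturbation_coercive y : 3 / 4 * dot y y <= dot y (S *m y).
Proof.
rewrite /S mulmxBl mul1mx -scalemxAl dotDr dotNr dotZr.
have h0 := Sig0 y; have h1 := Sigc y; have yy := dot_ge0 y.
have := ler_norm (k * dot y (Sig *m y)); rewrite normrM (ger0_norm h0).
have : `|k| * dot y (Sig *m y) <= `|k| * (c * dot y y) by rewrite ler_wpM2l.
have : `|k| * c * dot y y <= 1 / 4 * dot y y by rewrite ler_wpM2r.
lra.
Qed.

(** The left side is [k^2 <b, Sig S^-1 b>], the second-order error of replacing the inverse by the
    identity. In terms of [y = S^-1 b], the claim becomes [p - 3 k q + 2 k^2 r >= 0], and
    [k q <= p / 4] by smallness of [k]. The factor [k] on the left lets one statement cover both
    signs. *)
Lemma resolvent_diff b :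
  k * dot b (invmx S *m b) - k * dot b b <= 2 * k ^+ 2 * dot b (Sig *m b).
Proof.
have uS : S \in unitmx := resolvent_unitmx perturbation_coercive.
set y := invmx S *m b.
have bE : b = y - k *: (Sig *m y).
  have -> : b = S *m y by rewrite /y mulKVmx.
  by rewrite /S mulmxBl mul1mx -scalemxAl.
have h0 := Sig0 y; have h2 := Sig2 y; have h3 := Sig0 (Sig *m y).
have sy : dot (Sig *m y) y = dot y (Sig *m y) by rewrite dotC.
have sy2 : dot y (Sig *m (Sig *m y)) = dot (Sig *m y) (Sig *m y).
  by rewrite dot_mulmxr Sigsym.
have -> : dot b y = dot y y - k * dot y (Sig *m y).
  by rewrite {1}bE dotDl dotNl dotZl sy.
have -> : dot b b = dot y y - 2 * k * dot y (Sig *m y)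
    + k ^+ 2 * dot (Sig *m y) (Sig *m y).
  rewrite bE !(dotDl, dotDr, dotNl, dotNr, dotZl, dotZr) sy; ring.
have -> : dot b (Sig *m b) = dot y (Sig *m y)
    - 2 * k * dot (Sig *m y) (Sig *m y)
    + k ^+ 2 * dot (Sig *m y) (Sig *m (Sig *m y)).
  rewrite bE mulmxBr -scalemxAr.
  rewrite !(dotDl, dotDr, dotNl, dotNr, dotZl, dotZr) sy2; ring.
set p := dot y (Sig *m y) in h0 h2 *; set q := dot (Sig *m y) (Sig *m y) in h2 *.
set r := dot (Sig *m y) (Sig *m (Sig *m y)) in h3 *.
have q0 : 0 <= q := dot_ge0 _.
have kq : k * q <= 1 / 4 * p.
  apply: (@le_trans _ _ (`|k| * q)); first by rewrite ler_wpM2r ?ler_norm.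
  apply: (@le_trans _ _ (`|k| * (c * p))); first by rewrite ler_wpM2l.
  by rewrite mulrA ler_wpM2r.
rewrite -subr_ge0.
have -> : 2 * k ^+ 2 * (p - 2 * k * q + k ^+ 2 * r)
  - (k * (dot y y - k * p) - k * (dot y y - 2 * k * p + k ^+ 2 * q)) =
  k ^+ 2 * (p - 3 * (k * q) + 2 * k ^+ 2 * r) by ring.
apply: mulr_ge0; first exact: sqr_ge0.
have : 0 <= k ^+ 2 * r by rewrite mulr_ge0// sqr_ge0.
lra.
Qed.

End ResolventPerturbation.
End Dot.

(** * Sub-Gaussian moment generating functions *)

Section ExpBounds.
Context {R : realType}.
Implicit Types x y u : R.

(** Everything comes from [1 - x <= exp (- x)]. For [x >= 0] it gives [exp x - 1 <= x exp x], used
    twice; for [x < 0] it gives [exp x <= 1 / (1 - x)], which is at most [1 + x + x^2] because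
    [(1 + x + x^2) (1 - x) = 1 - x^3]. *)
Lemma expR_le_quadratic x : expR x <= 1 + x + x ^+ 2 * expR `|x|.
Proof.
have [x0|x0] := leP 0 x.
  have h : expR x - 1 <= x * expR x.
    have := expR_ge1Dx (- x); rewrite expRN => h.
    have e0 := expR_gt0 x.
    have : (1 - x) * expR x <= (expR x)^-1 * expR x by rewrite ler_pM2r.
    rewrite mulVf ?gt_eqF//; lra.
  rewrite ger0_norm//.
  have : x * (expR x - 1) <= x * (x * expR x) by rewrite ler_wpM2l.
  lra.
have h : expR x * (1 - x) <= 1.
  have := expR_ge1Dx (- x) => h.
  have : expR x * (1 - x) <= expR x * expR (- x) by rewrite ler_pM2l ?expR_gt0.
  by rewrite -expRD subrr expR0.
have h1 : 1 <= expR `|x| by rewrite -expR0 ler_expR.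
have : x ^+ 2 * 1 <= x ^+ 2 * expR `|x| by rewrite ler_wpM2l ?sqr_ge0.
have e0 := expR_gt0 x.
suff : expR x <= 1 + x + x ^+ 2 by lra.
have h2 : 1 <= (1 + x + x ^+ 2) * (1 - x).
  suff : 0 <= (- x) ^+ 3 by lra.
  by rewrite exprn_ge0// oppr_ge0 ltW.
have x1 : 0 < 1 - x by lra.
by rewrite -(ler_pM2r x1) (le_trans h).
Qed.

Lemma expR_half_le2 : expR 2^-1 <= 2 :> R.
Proof.
have := expR_ge1Dx (- 2^-1 : R); rewrite expRN => h.
have e0 := expR_gt0 (2^-1 : R); rewrite -[leRHS]invrK -[leLHS]invrK.
by rewrite lef_pV2 ?posrE ?invr_gt0//; lra.
Qed.

Lemma expR1_le4 : expR 1 <= 4 :> R.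
Proof.
rewrite [X in expR X](_ : 1 = 2^-1 + 2^-1); last by field.
rewrite expRD; have := expR_gt0 (2^-1 : R); have := expR_half_le2; nra.
Qed.

Lemma sqr_le_expR u : 0 <= u -> u ^+ 2 <= 2 * expR u.
Proof. by move=> u0; have := expR_ge1Dxn 1 u0; rewrite (_ : 2`! = 2)//; lra. Qed.

(* [x = s Y], [u = |Y| / L] and [|s| L <= 1]. *)
Lemma expR_lin_le s y L : 0 < L -> (s * L) ^+ 2 <= 1 ->
  expR (s * y) <= 1 + s * y + 4 * (s * L) ^+ 2 * expR (y ^+ 2 / L ^+ 2).
Proof.
move=> L0 sL; apply: le_trans (expR_le_quadratic _) _; rewrite lerD2l.
set u := `|y| / L; have u0 : 0 <= u by rewrite divr_ge0// ltW.
have uE : y ^+ 2 / L ^+ 2 = u ^+ 2 by rewrite /u expr_div_n real_normK ?num_real.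
rewrite uE.
have sy : s * y = (s * L) * (y / L) by field; rewrite gt_eqF.
have sL1 : `|s * L| <= 1 by rewrite -(@expr_le1 _ 2)// real_normK ?num_real.
have nsy : `|s * y| <= u.
  rewrite sy normrM normf_div (gtr0_norm L0) -/u; exact: ler_piMl.
have -> : (s * y) ^+ 2 = (s * L) ^+ 2 * u ^+ 2.
  by rewrite -uE sy exprMn expr_div_n.
rewrite [leRHS](_ : _ = (s * L) ^+ 2 * (4 * expR (u ^+ 2))); last by ring.
rewrite -mulrA ler_wpM2l ?sqr_ge0//.
(* The weight [exp (u^2)] is split into two halves [exp (u^2 / 2)]: one pays for [exp u], the other
   for [u^2]. *)
have h1 : expR `|s * y| <= expR (2^-1 + u ^+ 2 / 2).
  by rewrite ler_expR (le_trans nsy)//; have := sqr_ge0 (u - 1); lra.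
have h2 : u ^+ 2 <= 2 * expR (u ^+ 2 / 2).
  by have := expR_ge1Dx (u ^+ 2 / 2); lra.
have h3 := expR_half_le2.
have -> : expR (u ^+ 2) = expR (u ^+ 2 / 2) * expR (u ^+ 2 / 2).
  by rewrite -expRD; congr expR; field.
rewrite expRD in h1; set E := expR (u ^+ 2 / 2) in h1 h2 *.
have E0 : 0 < E := expR_gt0 _.
apply: (@le_trans _ _ (u ^+ 2 * (2 * E))).
  by rewrite ler_wpM2l ?sqr_ge0// (le_trans h1)// ler_pM2r.
apply: (@le_trans _ _ (2 * E * (2 * E))); first by rewrite ler_pM2r ?mulr_gt0.
lra.
Qed.

(** For large [s] the linear term cannot be exploited, so Young's inequality separates [s] from [y].
    Under the sub-Gaussian hypothesis the last factor has mean at most 3/2. *)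
Lemma expR_lin_le_large s y L : 0 < L -> 1 <= (s * L) ^+ 2 ->
  expR (s * y) <= expR ((s * L) ^+ 2) * (2^-1 + 2^-1 * expR (y ^+ 2 / L ^+ 2)).
Proof.
move=> L0 sL; set a := s * L; set z := y / L.
have -> : s * y = a * z by rewrite /a /z; field; rewrite gt_eqF.
have -> : y ^+ 2 / L ^+ 2 = z ^+ 2 by rewrite /z expr_div_n.
have h : expR (a * z) <= expR (a ^+ 2) * expR (z ^+ 2 / 2).
  by rewrite -expRD ler_expR; have := sqr_ge0 (a - z); have := sqr_ge0 a; lra.
apply: (le_trans h); rewrite ler_pM2l ?expR_gt0//.
rewrite [X in _ + _ * expR X](_ : _ = z ^+ 2 / 2 + z ^+ 2 / 2); last by field.
rewrite expRD; have := sqr_ge0 (expR (z ^+ 2 / 2) - 1); lra.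
Qed.

(** With [z = (y^2 + 1) / L^2], the smallness of [b] gives [|x| <= z / 4]. The constant is
    [512 = 4 * 32 * 4], from [x^2 <= 4 (b L^2)^2 z^2], [z^2 <= 32 exp (z / 4)] and
    [exp (1 / L^2) <= 4]. *)
Lemma expR_sqr_le b y L : 1 <= L -> `|b| * L ^+ 2 <= 1 / 8 ->
  expR (2 * b * (y ^+ 2 - 1)) <= 1 - 2 * b + 2 * b * y ^+ 2
     + 512 * (b * L ^+ 2) ^+ 2 * expR (y ^+ 2 / L ^+ 2).
Proof.
move=> L1 bL; apply: le_trans (expR_le_quadratic _) _.
have L0 : 0 < L by lra.
have L20 : 0 < L ^+ 2 by rewrite exprn_gt0.
have -> : 1 - 2 * b + 2 * b * y ^+ 2 = 1 + 2 * b * (y ^+ 2 - 1) by ring.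
rewrite lerD2l.
set x := 2 * b * (y ^+ 2 - 1); set z := (y ^+ 2 + 1) / L ^+ 2.
have z0 : 0 <= z by rewrite divr_ge0 ?addr_ge0 ?sqr_ge0.
have zE : z * L ^+ 2 = y ^+ 2 + 1 by rewrite /z mulfVK ?gt_eqF.
have hx : `|x| <= 2 * (`|b| * L ^+ 2) * z.
  have -> : 2 * (`|b| * L ^+ 2) * z = 2 * (`|b| * (y ^+ 2 + 1)) by rewrite -zE; ring.
  rewrite /x !normrM (ger0_norm (_ : 0 <= 2))// -mulrA.
  rewrite ler_wpM2l// ler_wpM2l// ler_norml; have := sqr_ge0 y; lra.
have hx1 : `|x| <= z / 4.
  by apply: (le_trans hx); have := ler_wpM2r z0 bL; lra.
have hx2 : x ^+ 2 <= 4 * (b * L ^+ 2) ^+ 2 * z ^+ 2.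
  have -> : 4 * (b * L ^+ 2) ^+ 2 * z ^+ 2 = (2 * (`|b| * L ^+ 2) * z) ^+ 2.
    by rewrite !exprMn real_normK ?num_real//; ring.
  rewrite -(real_normK (num_real x)) lerXn2r ?nnegrE//.
  by rewrite mulr_ge0// mulr_ge0// mulr_ge0// ltW.
have hz : z ^+ 2 <= 32 * expR (z / 4).
  have := sqr_le_expR (divr_ge0 z0 (ler0n R 4)); lra.
have hE : expR z <= 4 * expR (y ^+ 2 / L ^+ 2).
  rewrite /z mulrDl expRD mulrC ler_pM2r ?expR_gt0//.
  apply: le_trans expR1_le4; rewrite ler_expR mul1r invf_le1// expr_ge1//; lra.
have h4 : expR (z / 4) * expR (z / 4) <= expR z.
  by rewrite -expRD ler_expR; lra.
set B := (b * L ^+ 2) ^+ 2 in hx2 *; have B0 : 0 <= B by exact: sqr_ge0.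
set G := expR (y ^+ 2 / L ^+ 2) in hE *.
apply: (@le_trans _ _ (4 * B * z ^+ 2 * expR (z / 4))).
  apply: ler_pM; rewrite ?sqr_ge0 ?expR_ge0//; by rewrite ler_expR.
apply: (@le_trans _ _ (4 * B * (32 * expR (z / 4)) * expR (z / 4))).
  rewrite ler_pM2r ?expR_gt0// ler_wpM2l// mulr_ge0//.
have : B * (expR (z / 4) * expR (z / 4)) <= B * (4 * G).
  by rewrite ler_wpM2l// (le_trans h4).
lra.
Qed.

End ExpBounds.

Section SubGaussian.
Context {R : realType} d (T : measurableType d) (P : probability T R).

Definition std_subgaussian (L : R) (Y : T -> R) : Prop :=
  [/\ measurable_fun setT Y, (\int[P]_w (Y w)%:E = 0)%E,
      (\int[P]_w (Y w ^+ 2)%:E = 1)%E &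
      (\int[P]_w (expR (Y w ^+ 2 / L ^+ 2))%:E <= 2%:E)%E].

(** Turns pointwise bounds into bounds on means: the linear term integrates to 0, the square to 1,
    the exponential weight to at most 2. Integrability of [Y] and [Y^2] is by domination by
    [(1 + L^2) G]. *)
Lemma integral_le_affine L Y (f : R -> R) a0 a1 a2 a3 :
  std_subgaussian L Y -> 0 < L -> 0 <= a3 -> measurable_fun setT f ->
  (forall y, 0 <= f y) ->
  (forall y, f y <= a0 + a1 * y + a2 * y ^+ 2 + a3 * expR (y ^+ 2 / L ^+ 2)) ->
  (\int[P]_w (f (Y w))%:E <= (a0 + a2 + 2 * a3)%:E)%E.
Proof.
move=> [mY Y1 Y2 YL] L0 a30 mf f0 hf.
have mG : measurable_fun setT (fun w => expR (Y w ^+ 2 / L ^+ 2)).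
  apply: measurableT_comp => //; apply: measurable_funM => //.
  exact: measurable_funX.
set G := fun w => expR (Y w ^+ 2 / L ^+ 2) in mG *.
have G1 w : 1 <= G w.
  by rewrite -expR0 ler_expR divr_ge0 ?sqr_ge0.
have G2 w : Y w ^+ 2 <= L ^+ 2 * G w.
  have := expR_ge1Dx (Y w ^+ 2 / L ^+ 2); rewrite -/(G w) => h.
  by rewrite mulrC -ler_pdivrMr ?exprn_gt0//; lra.
have iG : P.-integrable setT (EFin \o G).
  apply/integrableP; split; first exact/measurable_EFinP.
  rewrite (le_lt_trans _ (ltry 2))//; apply: le_trans YL.
  rewrite le_eqVlt; apply/orP; left; apply/eqP.
  by apply: eq_integral => w _ /=; rewrite ger0_norm// expR_ge0.
have iG' : P.-integrable setT (fun w => ((1 + L ^+ 2)%:E * (G w)%:E)%E).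
  exact: (integrableZl measurableT (1 + L ^+ 2) iG).
have iY2 : P.-integrable setT (EFin \o (fun w => Y w ^+ 2)).
  apply: le_integrable iG' => //.
    by apply/measurable_EFinP; exact: measurable_funX.
  move=> w _ /=; rewrite lee_fin !ger0_norm ?sqr_ge0//.
    by have := G2 w; have := G1 w; lra.
  by rewrite mulr_ge0 ?expR_ge0// addr_ge0 ?sqr_ge0.
have iY : P.-integrable setT (EFin \o Y).
  apply: le_integrable iG' => //; first exact/measurable_EFinP.
  move=> w _ /=; rewrite lee_fin (ger0_norm (_ : 0 <= (1 + L ^+ 2) * G w)).
    rewrite ler_norml; have := G2 w; have := G1 w.
    by have := sqr_ge0 (Y w - 1); have := sqr_ge0 (Y w + 1); lra.
  by rewrite mulr_ge0 ?expR_ge0// addr_ge0 ?sqr_ge0.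
pose g w := ((a0%:E + a1%:E * (Y w)%:E) + a2%:E * (Y w ^+ 2)%:E
              + a3%:E * (G w)%:E)%E.
have i0 : P.-integrable setT (fun _ : T => a0%:E).
  exact: finite_measure_integrable_cst.
have i1 : P.-integrable setT (fun w => (a1%:E * (Y w)%:E)%E).
  exact: (integrableZl measurableT a1 iY).
have i2 : P.-integrable setT (fun w => (a2%:E * (Y w ^+ 2)%:E)%E).
  exact: (integrableZl measurableT a2 iY2).
have i3 : P.-integrable setT (fun w => (a3%:E * (G w)%:E)%E).
  exact: (integrableZl measurableT a3 iG).
have i01 := integrableD measurableT i0 i1.
have i012 := integrableD measurableT i01 i2.
have i0123 := integrableD measurableT i012 i3.
apply: (@le_trans _ _ (\int[P]_w g w)%E).
  apply: ge0_le_integral => //.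
  - by move=> w _; rewrite lee_fin.
  - by apply/measurable_EFinP; exact: measurableT_comp.
  - by case/integrableP: i0123.
  - by move=> w _; rewrite /g -!EFinM -!EFinD lee_fin.
rewrite /g integralD// integralD// integralD//.
rewrite integral_cst// [X in (_ * X)%E](_ : _ = 1%E); last exact: probability_setT.
rewrite mule1.
rewrite (integralZl measurableT iY)/= Y1 mule0 adde0.
rewrite (integralZl measurableT iY2)/= Y2 mule1.
rewrite (integralZl measurableT iG)/= EFinD leeD2l//.
by rewrite (mulrC 2) EFinM lee_wpmul2l// lee_fin.
Qed.

(** No smallness is asked of [a], since in the recursion it is an unbounded function of the earlier
    coordinates; hence the case split on [(2 a L)^2]. Linear and centred quadratic parts are
    estimated separately with doubled exponents, then recombined. *)
Lemma subgaussian_mgf L Y a b : std_subgaussian L Y -> 1 <= L ->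
  `|b| * L ^+ 2 <= 1 / 8 ->
  (\int[P]_w (expR (a * Y w + b * Y w ^+ 2))%:E <=
   (expR (b + 32 * (a * L) ^+ 2 + 1024 * (b * L ^+ 2) ^+ 2))%:E)%E.
Proof.
move=> sY L1 bL; have L0 : 0 < L by lra.
have h1 : (\int[P]_w (expR (2 * a * Y w))%:E <=
    (expR (32 * (a * L) ^+ 2))%:E)%E.
  have mf : measurable_fun setT (fun y : R => expR (2 * a * y)).
    by apply: measurableT_comp => //; exact: measurable_funM.
  have hs : (2 * a * L) ^+ 2 = 4 * (a * L) ^+ 2 by ring.
  have al0 : 0 <= (a * L) ^+ 2 := sqr_ge0 _.
  have [h|h] := leP ((2 * a * L) ^+ 2) 1.
  - apply: (le_trans (integral_le_affine (f := fun y => expR (2 * a * y))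
      (a0 := 1) (a1 := 2 * a) (a2 := 0) (a3 := 4 * (2 * a * L) ^+ 2) sY L0 _ mf _ _)).
    + exact: mulr_ge0 (ler0n _ _) (sqr_ge0 _).
    + by move=> y; rewrite expR_ge0.
    + by move=> y; rewrite mul0r addr0; exact: expR_lin_le.
    + rewrite lee_fin hs; have := expR_ge1Dx (32 * (a * L) ^+ 2); lra.
  - have e0 := expR_ge0 ((2 * a * L) ^+ 2).
    apply: (le_trans (integral_le_affine (f := fun y => expR (2 * a * y))
      (a0 := expR ((2 * a * L) ^+ 2) / 2) (a1 := 0) (a2 := 0)
      (a3 := expR ((2 * a * L) ^+ 2) / 2) sY L0 _ mf _ _)).
    + by rewrite divr_ge0.
    + by move=> y; rewrite expR_ge0.
    + by move=> y; rewrite !mul0r !addr0; have := expR_lin_le_large y L0 (ltW h); lra.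
    + rewrite lee_fin.
      apply: (@le_trans _ _ (expR ((2 * a * L) ^+ 2) * expR 1)).
        by have := ler_wpM2l e0 (expR_ge1Dx (1 : R)); lra.
      by rewrite -expRD ler_expR; lra.
have h2 : (\int[P]_w (expR (2 * b * (Y w ^+ 2 - 1)))%:E <=
    (expR (1024 * (b * L ^+ 2) ^+ 2))%:E)%E.
  apply: (le_trans (integral_le_affine (f := fun y => expR (2 * b * (y ^+ 2 - 1)))
      (a0 := 1 - 2 * b) (a1 := 0) (a2 := 2 * b) (a3 := 512 * (b * L ^+ 2) ^+ 2)
      sY L0 _ _ _ _)).
  - exact: mulr_ge0 (ler0n _ _) (sqr_ge0 _).
  - apply: measurableT_comp => //; apply: measurable_funM => //.
    by apply: measurable_funB => //; exact: measurable_funX.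
  - by move=> y; rewrite expR_ge0.
  - by move=> y; rewrite mul0r addr0; exact: expR_sqr_le.
  - rewrite lee_fin; have := expR_ge1Dx (1024 * (b * L ^+ 2) ^+ 2); lra.
have [mY _ _ _] := sY.
have mX1 : measurable_fun setT (fun w => expR (2 * a * Y w)).
  by apply: measurableT_comp => //; exact: measurable_funM.
have mX2 : measurable_fun setT (fun w => expR (2 * b * (Y w ^+ 2 - 1))).
  apply: measurableT_comp => //; apply: measurable_funM => //.
  by apply: measurable_funB => //; exact: measurable_funX.
(* [exp (p + q) <= (exp (2 p) + exp (2 q)) / 2] replaces Cauchy-Schwarz. *)
apply: (@le_trans _ _ (\int[P]_w ((expR b / 2)%:E * (expR (2 * a * Y w) +
   expR (2 * b * (Y w ^+ 2 - 1)))%:E))%E).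
  apply: ge0_le_integral => //.
  - apply/measurable_EFinP; apply: measurableT_comp => //.
    apply: measurable_funD; apply: measurable_funM => //.
    exact: measurable_funX.
  - apply/measurable_EFinP; apply: measurable_funM => //.
    exact: measurable_funD.
  - move=> w _; rewrite lee_fin.
    set p := a * Y w; set q := b * (Y w ^+ 2 - 1).
    have -> : a * Y w + b * Y w ^+ 2 = b + (p + q) by rewrite /p /q; ring.
    have -> : 2 * a * Y w = p + p by rewrite /p; ring.
    have -> : 2 * b * (Y w ^+ 2 - 1) = q + q by rewrite /q; ring.
    rewrite expRD -mulrA ler_pM2l ?expR_gt0// !expRD.
    by have := sqr_ge0 (expR p - expR q); lra.
have eb0 := expR_gt0 b.
rewrite ge0_integralZl//; last first.
  by apply/measurable_EFinP; exact: measurable_funD.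
under eq_integral do rewrite EFinD.
rewrite ge0_integralD//; [|exact/measurable_EFinP|exact/measurable_EFinP].
apply: (@le_trans _ _ ((expR b / 2)%:E *
  ((expR (32 * (a * L) ^+ 2))%:E + (expR (1024 * (b * L ^+ 2) ^+ 2))%:E))%E).
  by rewrite lee_wpmul2l ?lee_fin ?divr_ge0 ?expR_ge0// leeD.
rewrite -EFinD -EFinM lee_fin -addrA expRD -mulrA ler_pM2l//.
set p := 32 * _; set q := 1024 * _.
have p0 : 0 <= p := mulr_ge0 (ler0n _ _) (sqr_ge0 _).
have q0 : 0 <= q := mulr_ge0 (ler0n _ _) (sqr_ge0 _).
have : expR p <= expR (p + q) by rewrite ler_expR; lra.
have : expR q <= expR (p + q) by rewrite ler_expR; lra.
lra.
Qed.

End SubGaussian.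

(** * Independence *)

Section Independence.
Context {R : realType} d (T : measurableType d) (P : probability T R).
Local Open Scope ereal_scope.

(** Factorization on rectangles identifies the law of [(Z, Y)] with the product of the two laws;
    Tonelli then applies. *)
Lemma indep_fubini d' (T' : measurableType d') (Z : T -> T') (Y : T -> R)
    (F : T' * R -> \bar R) :
  measurable_fun setT Z -> measurable_fun setT Y -> measurable_fun setT F ->
  (forall x, 0 <= F x) ->
  (forall A B, measurable A -> measurable B ->
    P (Z @^-1` A `&` Y @^-1` B) = P (Z @^-1` A) * P (Y @^-1` B)) ->
  \int[P]_w F (Z w, Y w) = \int[P]_w \int[P]_v F (Z w, Y v).
Proof.
move=> mZ mY mF F0 ZY.
have mZY : measurable_fun setT (fun w => (Z w, Y w)) by exact: measurable_fun_pair.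
pose Zm : {mfun T >-> T'} := mfun_Sub (mem_set mZ).
pose Ym : {mfun T >-> R} := mfun_Sub (mem_set mY).
pose ZYm : {mfun T >-> (T' * R)%type} := mfun_Sub (mem_set mZY).
have -> : \int[P]_w F (Z w, Y w) = \int[distribution P ZYm]_z F z.
  by rewrite ge0_integral_pushforward.
rewrite (eq_measure_integral (distribution P Zm \x distribution P Ym)); last first.
  move=> A mA _; apply/esym; apply: product_measure_unique => //.
rewrite fubini_tonelli1// ge0_integral_pushforward//; last 2 first.
- exact: measurable_fun_fubini_tonelli_F.
- by move=> z _; exact: integral_ge0.
rewrite preimage_setT; apply: eq_integral => w _ /=; rewrite /fubini_F.
rewrite ge0_integral_pushforward//.
exact: (measurableT_comp mF (pair1_measurable _)).
Qed.

Definition history (Y : nat -> T -> R) n : set_system T :=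
  [set A | exists2 E : nat -> set R, (forall j, measurable (E j)) &
     A = \bigcap_(j < n) (Y j @^-1` E j)].

Lemma history_setI_closed Y n : setI_closed (history Y n).
Proof.
move=> _ _ [E mE ->] [F mF ->]; exists (fun j => E j `&` F j).
  by move=> j; exact: measurableI.
by rewrite -bigcapI.
Qed.

Lemma history_measurable Y n : (forall j, measurable_fun setT (Y j)) ->
  history Y n `<=` measurable.
Proof.
move=> mY _ [E mE ->]; apply: bigcap_measurableType => j _.
by rewrite -[_ @^-1` _]setTI; exact: mY.
Qed.

Lemma sigma_history_measurable Y n : (forall j, measurable_fun setT (Y j)) ->
  <<s history Y n >> `<=` measurable.
Proof.
move=> mY; apply: smallest_sub; first exact: sigma_algebra_measurable.
exact: history_measurable.
Qed.

Definition independent_seq (Y : nat -> T -> R) N :=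
  forall E : nat -> set R, (forall j, measurable (E j)) ->
  P (\bigcap_(j < N) (Y j @^-1` E j)) = \prod_(j < N) P (Y j @^-1` E j).

Lemma independent_seq_le Y N n : (n <= N)%N ->
  independent_seq Y N -> independent_seq Y n.
Proof.
move=> nN YN E mE; pose F j := if (j < n)%N then E j else setT.
have FE : \bigcap_(j < n) (Y j @^-1` E j) = \bigcap_(j < N) (Y j @^-1` F j).
  apply/seteqP; split => w h j /= jn; rewrite /F.
    by case: ifP => // jn'; exact: h.
  by have := h j (leq_trans jn nN); rewrite /F jn.
rewrite FE YN; last by move=> j; rewrite /F; case: ifP.
rewrite (big_ord_widen N (fun j => P (Y j @^-1` E j))) //.
rewrite [RHS]big_mkcond; apply: eq_bigr => j _; rewrite /F; case: ifP => // _.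
by rewrite preimage_setT; exact: probability_setT.
Qed.

(** For fixed [B], both sides are finite measures in [A]: a restriction and a multiple of [P]. They
    agree on the pi-system of cylinder events, hence on the sigma-algebra it generates. *)
Lemma history_indep Y N n : (n < N)%N ->
  (forall j, measurable_fun setT (Y j)) -> independent_seq Y N ->
  forall A B, <<s history Y n >> A -> measurable B ->
    P (A `&` Y n @^-1` B) = P A * P (Y n @^-1` B).
Proof.
move=> nN mY YN A B hA mB.
set C := Y n @^-1` B.
have mC : measurable C by rewrite -[C]setTI; exact: mY.
have Cfin : P C \is a fin_num by exact: fin_num_measure.
have C0 : (0 <= fine (P C))%R by rewrite fine_ge0.
pose m2 := mscale (NngNum C0) P.
transitivity (m2 A); last by rewrite /m2 /mscale /= fineK// muleC.
have mHT : history Y n `<=` measurable by exact: history_measurable.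
have HI := @history_setI_closed Y n.
have HT : history Y n setT.
  exists (fun=> setT) => //; apply/seteqP; split => // w _ j _ //.
apply: (@g_sigma_algebra_measure_unique _ _ _ (history Y n) mHT (fun=> setT) _ _
  (mrestr P mC) m2) => //.
- by rewrite bigcup_const.
- move=> _ [E mE ->]; rewrite -[LHS]/(P (_ `&` C)) -[RHS]/((fine (P C))%:E * P _) fineK//.
  pose F j := if (j < n)%N then E j else B.
  have mF j : measurable (F j) by rewrite /F; case: ifP.
  have -> : \bigcap_(j < n) (Y j @^-1` E j) `&` C =
      \bigcap_(j < n.+1) (Y j @^-1` F j).
    apply/seteqP; split => w.
      move=> [h Cw] j /=; rewrite ltnS leq_eqVlt => /orP[/eqP->|jn].
        by rewrite /F ltnn.
      by rewrite /F jn; exact: h.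
    move=> h; split => [j /= jn|].
      by have := h j (ltnW jn); rewrite /F jn.
    by have := h n (ltnSn n); rewrite /F ltnn.
  rewrite (independent_seq_le nN YN)// big_ord_recr /= {2}/F ltnn muleC.
  congr (_ * _); rewrite (independent_seq_le (ltnW nN) YN)//.
  by apply: eq_bigr => j _; rewrite /F ltn_ord.
- by move=> _; rewrite -[X in X < _]/(P (_ `&` C)) setTI -ge0_fin_numE.
Qed.

Lemma history_fun_measurable Y n j : (j < n)%N ->
  measurable_fun setT (Y j : g_sigma_algebraType (history Y n) -> R).
Proof.
move=> jn _ B mB; apply: sub_sigma_algebra.
exists (fun i => if i == j then B else setT).
  by move=> i; case: ifP.
apply/seteqP; split => w /=.
  by move=> [_ Bw] i _ /=; case: eqP => // ->.
by move=> h; split => //; have := h j jn; rewrite /= eqxx.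
Qed.


Lemma history_id_measurable Y n : (forall j, measurable_fun setT (Y j)) ->
  measurable_fun setT (id : T -> g_sigma_algebraType (history Y n)).
Proof.
by move=> mY _ B mB; rewrite setTI; apply: (sigma_history_measurable mY); exact: mB.
Qed.

(** Conditioning on the past is expressed by [indep_fubini] with [Z] the identity of [T] into [T]
    carrying the history sigma-algebra. Then [q0] and [q1] are frozen while [subgaussian_mgf]
    integrates out [Y n]. *)
Lemma subgaussian_step Y N n L (q0 q1 : g_sigma_algebraType (history Y n) -> R)
    (b : R) :
  (n < N)%N -> (forall j, measurable_fun setT (Y j)) -> independent_seq Y N ->
  std_subgaussian P L (Y n) -> (1 <= L)%R -> (`|b| * L ^+ 2 <= 1 / 8)%R ->
  measurable_fun setT q0 -> measurable_fun setT q1 ->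
  \int[P]_w (expR (q0 w + q1 w * Y n w + b * Y n w ^+ 2))%:E <=
  (expR (b + 1024 * (b * L ^+ 2) ^+ 2))%:E *
    \int[P]_w (expR (q0 w + 32 * (q1 w * L) ^+ 2))%:E.
Proof.
move=> nN mY YN sY L1 bL mq0 mq1.
have [e eE] : {e : R | e = expR (b + 1024 * (b * L ^+ 2) ^+ 2)} by eexists.
have e0 : (0 <= e)%R by rewrite eE expR_ge0.
rewrite -eE.
have mid := @history_id_measurable Y n mY.
pose T' := g_sigma_algebraType (history Y n).
pose f (z : T' * R) : R := expR (q0 z.1 + q1 z.1 * z.2 + b * z.2 ^+ 2).
have mf : measurable_fun setT (EFin \o f).
  apply/measurable_EFinP; apply: measurableT_comp => //.
  have m1 : measurable_fun setT (fun z : T' * R => q1 z.1 * z.2)%R.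
    by apply: measurable_funM => //; exact: measurableT_comp.
  apply: measurable_funD.
    by apply: measurable_funD => //; exact: measurableT_comp.
  by apply: measurable_funM => //; exact: measurable_funX.
have mq0' : measurable_fun setT (q0 : T -> R) := measurableT_comp mq0 mid.
have mq1' : measurable_fun setT (q1 : T -> R) := measurableT_comp mq1 mid.
have -> : \int[P]_w (expR (q0 w + q1 w * Y n w + b * Y n w ^+ 2))%:E =
    \int[P]_w (EFin \o f) ((w : T'), Y n w) by [].
rewrite (@indep_fubini _ T' id)//; last 2 first.
- by move=> z; rewrite lee_fin expR_ge0.
- by move=> A B mA mB; rewrite preimage_id; exact: (history_indep nN mY YN).
have mF : measurable_fun [set: T] (fun w : T => \int[P]_v (EFin \o f) ((w : T'), Y n v)).
  have mf2 : measurable_fun setT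
      (fun z : T * T => (EFin \o f) ((z.1 : T'), Y n z.2)).
    apply: (measurableT_comp mf); apply: measurable_fun_pair.
      exact: (measurableT_comp mid measurable_fst).
    exact: (measurableT_comp (mY n) measurable_snd).
  apply: (measurable_fun_fubini_tonelli_F (m2 := P) _ mf2) => z.
  by rewrite lee_fin expR_ge0.
have mG : measurable_fun [set: T] (fun w : T => expR (q0 w + 32 * (q1 w * L) ^+ 2)).
  apply: measurableT_comp => //; apply: measurable_funD => //.
  apply: measurable_funM => //; apply: measurable_funX.
  exact: measurable_funM.
apply: (@le_trans _ _ (\int[P]_(w in [set: T])
    (e%:E * (expR (q0 w + 32 * (q1 w * L) ^+ 2))%:E))); last first.
  by rewrite ge0_integralZl//; exact/measurable_EFinP.
apply: ge0_le_integral => //.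
- by move=> w _; apply: integral_ge0 => v _; rewrite lee_fin expR_ge0.
- by apply/measurable_EFinP; exact: measurable_funM.
move=> w _; rewrite /f /=.
under eq_integral do rewrite -addrA expRD EFinM.
rewrite ge0_integralZl//; last first.
  apply/measurable_EFinP; apply: measurableT_comp => //.
  apply: measurable_funD; apply: measurable_funM => //.
  exact: measurable_funX.
apply: (@le_trans _ _ ((expR (q0 w))%:E *
    (expR (b + 32 * (q1 w * L) ^+ 2 + 1024 * (b * L ^+ 2) ^+ 2))%:E)).
  rewrite lee_wpmul2l// ?lee_fin ?expR_ge0//.
  exact: subgaussian_mgf.
by rewrite eE -!EFinM lee_fin -!expRD ler_expR; lra.
Qed.

End Independence.

(** * The Hanson-Wright inequality *)

Section TailGram.
Context {R : realType} (m : nat) (b : nat -> 'cV[R]_m) (N : nat) (c : R).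
Hypothesis c0 : 0 < c.
Hypothesis bc : forall y, \sum_(0 <= j < N) dot (b j) y ^+ 2 <= c * dot y y.

Definition tail_gram n : 'M[R]_m := \sum_(n <= j < N) b j *m (b j)^T.

Lemma tail_gram_sym n : (tail_gram n)^T = tail_gram n.
Proof.
rewrite /tail_gram [LHS]linear_sum /=; apply: eq_bigr => j _.
by rewrite trmx_mul trmxK.
Qed.

Lemma tail_gram_mul n y : tail_gram n *m y = \sum_(n <= j < N) dot (b j) y *: b j.
Proof.
rewrite /tail_gram mulmx_suml; apply: eq_bigr => j _.
by rewrite -mulmxA [(b j)^T *m y]mx11_scalar mul_mx_scalar.
Qed.

Lemma tail_gram_dot n y :
  dot y (tail_gram n *m y) = \sum_(n <= j < N) dot (b j) y ^+ 2.
Proof.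
rewrite tail_gram_mul dot_sumr; apply: eq_bigr => j _.
by rewrite dotZr (dotC y) expr2.
Qed.

Lemma tail_gram_ge0 n y : 0 <= dot y (tail_gram n *m y).
Proof. by rewrite tail_gram_dot sumr_ge0// => j _; exact: sqr_ge0. Qed.

Lemma tail_gram_le n y : dot y (tail_gram n *m y) <= c * dot y y.
Proof.
apply: le_trans (bc y); rewrite tail_gram_dot.
have [nN|Nn] := leqP n N; last first.
  by rewrite big_geq ?(ltnW Nn)// sumr_ge0// => j _; exact: sqr_ge0.
rewrite [leRHS](big_cat_nat (leq0n n) nN)/= lerDr sumr_ge0// => j _; exact: sqr_ge0.
Qed.

(** Positivity of the form at [y - c^-1 z], combined with [<z, tail_gram n z> <= c |z|^2]. *)
Lemma tail_gram_sqr_le n y :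
  dot (tail_gram n *m y) (tail_gram n *m y) <= c * dot y (tail_gram n *m y).
Proof.
set z := tail_gram n *m y.
have := tail_gram_ge0 n (y - c^-1 *: z).
rewrite mulmxBr -scalemxAr -/z.
rewrite !(dotDl, dotDr, dotNl, dotNr, dotZl, dotZr).
have -> : dot y (tail_gram n *m z) = dot z z.
  by rewrite dot_mulmxr tail_gram_sym.
have := tail_gram_le n z; rewrite -/z.
set p := dot z (tail_gram n *m z); set q := dot z z; set r := dot y z => pq h.
have h' : 0 <= r - 2 * c^-1 * q + c^-1 * (c^-1 * p) by lra.
have : c^-1 * (c^-1 * p) <= c^-1 * q.
  rewrite ler_pM2l ?invr_gt0// -(ler_pM2l c0) mulrA divff ?mul1r ?gt_eqF//.
have : c * (r - c^-1 * q) = c * r - q by field; rewrite gt_eqF.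
move=> e1 e2; rewrite -subr_ge0 -e1; apply: mulr_ge0 (ltW c0) _; lra.
Qed.

Lemma tail_gramS n : (n < N)%N ->
  tail_gram n = b n *m (b n)^T + tail_gram n.+1.
Proof. by move=> nN; rewrite /tail_gram big_ltn. Qed.

End TailGram.

Section HansonWright.
Context {R : realType} d (T : measurableType d) (P : probability T R).
Context (m : nat) (b : nat -> 'cV[R]_m) (Y : nat -> T -> R) (N : nat) (L c lam : R).
Hypothesis L1 : 1 <= L.
Hypothesis mY : forall j, measurable_fun setT (Y j).
Hypothesis YN : independent_seq P Y N.
Hypothesis sY : forall j, (j < N)%N -> std_subgaussian P L (Y j).
Hypothesis c0 : 0 < c.
Hypothesis bc : forall y, \sum_(0 <= j < N) dot (b j) y ^+ 2 <= c * dot y y.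
Hypothesis b1 : \sum_(0 <= j < N) dot (b j) (b j) = 1.
Hypothesis lamc : `|lam| * (1024 * L ^+ 2 * c) <= 1.

(* With this [k], the Sherman-Morrison increment, at least
   [k / 2 * lam * u ^+ 2], is the [32 * (2 * lam * u * L) ^+ 2] produced by
   [subgaussian_mgf]. *)
Let k := 256 * L ^+ 2 * lam.
Let S n := 1%:M - k *: tail_gram b N n.
Definition partial_sum n w := \sum_(0 <= j < n) Y j w *: b j.
Let H n x := lam * dot x (invmx (S n) *m x).
(** The exponent paid for integrating out [Y n]: [H n.+1 (b n)] is the coefficient of the square of
    [Y n]. *)
Let cst n := H n.+1 (b n) + 1024 * (H n.+1 (b n) * L ^+ 2) ^+ 2.

Let kc : `|k| * c <= 1 / 4.
Proof.
rewrite /k normrM ger0_norm; last exact: mulr_ge0 (ler0n _ _) (sqr_ge0 _).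
move: lamc; lra.
Qed.

Let Ssym n : (S n)^T = S n.
Proof. exact: perturbation_sym (tail_gram_sym _ _ _). Qed.

Let Scoer n y : 3 / 4 * dot y y <= dot y (S n *m y).
Proof.
apply: (perturbation_coercive kc) => z; [exact: tail_gram_ge0|exact: tail_gram_le].
Qed.

Let Sunit n : S n \in unitmx := resolvent_unitmx (@Scoer n).

Let b_le n : (n < N)%N -> dot (b n) (b n) <= c.
Proof.
move=> nN; have [->|b0] := eqVneq (b n) 0; first by rewrite dot0r ltW.
have bn0 : 0 < dot (b n) (b n) by rewrite dot_gt0.
rewrite -(ler_pM2r bn0) -expr2; apply: le_trans (bc (b n)).
rewrite big_mkord (bigD1 (Ordinal nN))//= lerDl sumr_ge0// => j _; exact: sqr_ge0.
Qed.

Let H_le n x : `|H n x| <= 2 * `|lam| * dot x x.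
Proof.
have [h0 h1] := resolvent_dot_bounds (@Scoer n) x.
by rewrite /H normrM (ger0_norm h0) -mulrA mulrCA; apply: ler_wpM2l.
Qed.

(** [S n] is a rank-one update of [S n.+1] with [|s| <= |k| 2 c <= 1 / 2], so
    [1 / (1 - s) >= 1 / 2]. The increment is nonnegative for either sign of [lam], because [k] has
    the sign of [lam]. *)
Let H_step n x : (n < N)%N ->
  H n.+1 x + 128 * L ^+ 2 * (lam * dot (b n) (invmx (S n.+1) *m x)) ^+ 2 <= H n x.
Proof.
move=> nN; have SE : S n = S n.+1 - k *: (b n *m (b n)^T).
  by rewrite /S (tail_gramS b nN) scalerDr opprD addrA addrAC.
have uS := Sunit n; rewrite SE in uS.
set s := k * dot (b n) (invmx (S n.+1) *m b n).
have s2 : `|s| <= 1 / 2.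
  have [h0 h1] := resolvent_dot_bounds (@Scoer n.+1) (b n).
  rewrite /s normrM (ger0_norm h0).
  apply: (@le_trans _ _ (`|k| * (2 * c))).
    by rewrite ler_wpM2l// (le_trans h1)// ler_wpM2l// b_le.
  by move: kc; lra.
have s1 : 0 < 1 - s by have := ler_norm s; lra.
have s3 : 1 - s <= 2 by have := ler_norm (- s); rewrite normrN; lra.
have sn1 : s != 1 by rewrite eq_sym -subr_eq0 gt_eqF.
rewrite /H SE (sherman_morrison (@Ssym n.+1) (@Scoer n.+1) uS sn1) -/s.
rewrite mulrDr lerD2l; set u := dot (b n) _.
have -> : lam * (k / (1 - s) * u ^+ 2) = 256 * L ^+ 2 * (lam * u) ^+ 2 / (1 - s).
  by rewrite /k; field; rewrite gt_eqF.
rewrite ler_pdivlMr//.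
have : 0 <= L ^+ 2 * (lam * u) ^+ 2 by rewrite mulr_ge0 ?sqr_ge0.
move: (L ^+ 2 * (lam * u) ^+ 2) => v v0; nra.
Qed.

Let partial_sum_measurable n j (Q : 'M[R]_m) u : (j <= n)%N ->
  measurable_fun setT
    ((fun w => dot u (Q *m partial_sum j w)) :
       g_sigma_algebraType (history Y n) -> R).
Proof.
move=> jn; have -> : (fun w => dot u (Q *m partial_sum j w)) =
    (fun w => \sum_(0 <= i < j) Y i w * dot u (Q *m b i)).
  apply/funext => w; rewrite /partial_sum mulmx_sumr dot_sumr.
  by apply: eq_bigr => i _; rewrite -scalemxAr dotZr.
rewrite (_ : (fun w => _) = (fun w => \sum_(i < j) Y i w * dot u (Q *m b i))).
  apply: measurable_sum => i; apply: measurable_funM => //.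
  by apply: history_fun_measurable; exact: leq_trans (ltn_ord i) jn.
by apply/funext => w; rewrite big_mkord.
Qed.

Let partial_sum_quad_measurable n (Q : 'M[R]_m) :
  measurable_fun setT
    ((fun w => dot (partial_sum n w) (Q *m partial_sum n w)) :
       g_sigma_algebraType (history Y n) -> R).
Proof.
have -> : (fun w => dot (partial_sum n w) (Q *m partial_sum n w)) =
    (fun w => \sum_(i < n) Y i w * dot (b i) (Q *m partial_sum n w)).
  apply/funext => w; rewrite {1}/partial_sum big_mkord dotC dot_sumr.
  by apply: eq_bigr => i _; rewrite dotZr dotC.
apply: measurable_sum => i; apply: measurable_funM.
  exact: history_fun_measurable.
exact: partial_sum_measurable.
Qed.

Let H_measurable n : measurable_fun setT (fun w : T => H n (partial_sum n w)).
Proof.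
have h : measurable_fun setT
    ((fun w => dot (partial_sum n w) (invmx (S n) *m partial_sum n w)) : T -> R)
  := measurableT_comp (@partial_sum_quad_measurable n (invmx (S n)))
       (@history_id_measurable _ _ T Y n mY).
exact: measurable_funM.
Qed.

(** Expanding [H n.+1] at [W_n + Y_n b_n] gives a quadratic polynomial in [Y_n] with coefficients
    measurable for the past. After [subgaussian_step], [H_step] absorbs the square of the linear
    coefficient into [H n]. *)
Lemma partial_sum_mgf n : (n <= N)%N ->
  (\int[P]_w (expR (H n (partial_sum n w)))%:E <=
   (expR (\sum_(0 <= j < n) cst j))%:E)%E.
Proof.
elim: n => [_|n IHn nN].
  under eq_integral do rewrite /partial_sum big_geq// /H dot0l mulr0 expR0.
  rewrite big_geq// expR0 integral_cst//.
  by rewrite [X in (_ * X)%E](_ : _ = 1%E) ?mule1//; exact: probability_setT.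
have nN' := ltnW nN.
pose q0 w := H n.+1 (partial_sum n w).
pose q1 w := 2 * lam * dot (b n) (invmx (S n.+1) *m partial_sum n w).
have -> : (\int[P]_w (expR (H n.+1 (partial_sum n.+1 w)))%:E =
  \int[P]_w (expR (q0 w + q1 w * Y n w + H n.+1 (b n) * Y n w ^+ 2))%:E)%E.
  apply: eq_integral => w _; congr (expR _)%:E.
  rewrite /H /partial_sum big_nat_recr//= -/(partial_sum n w) mulmxDr -scalemxAr.
  rewrite !(dotDl, dotDr, dotZl, dotZr) /q0 /q1 /H.
  rewrite (resolvent_sym (@Ssym n.+1) (partial_sum n w) (b n)); ring.
have hb : `|H n.+1 (b n)| * L ^+ 2 <= 1 / 8.
  have h := H_le n.+1 (b n).
  have h2 : 2 * `|lam| * dot (b n) (b n) <= 2 * `|lam| * c.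
    by rewrite ler_wpM2l ?b_le// mulr_ge0.
  have : `|H n.+1 (b n)| * L ^+ 2 <= 2 * `|lam| * c * L ^+ 2.
    by rewrite ler_wpM2r ?sqr_ge0// (le_trans h).
  by move: lamc; lra.
have mq0 : measurable_fun setT (q0 : g_sigma_algebraType (history Y n) -> R).
  by apply: measurable_funM => //; exact: partial_sum_quad_measurable.
have mq1 : measurable_fun setT (q1 : g_sigma_algebraType (history Y n) -> R).
  by apply: measurable_funM => //; exact: partial_sum_measurable.
apply: (le_trans (subgaussian_step nN mY YN (sY nN) L1 hb mq0 mq1)).
rewrite -/(cst n) big_nat_recr//= [X in (_ <= (expR X)%:E)%E]addrC
  [X in (_ <= X%:E)%E]expRD EFinM.
rewrite lee_wpmul2l// ?lee_fin ?expR_ge0//.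
apply: le_trans (IHn nN').
have mid := @history_id_measurable _ _ T Y n mY.
have mq0' : measurable_fun setT (q0 : T -> R) := measurableT_comp mq0 mid.
have mq1' : measurable_fun setT (q1 : T -> R) := measurableT_comp mq1 mid.
have mHn := H_measurable n.
apply: ge0_le_integral => //.
- apply/measurable_EFinP; apply: measurableT_comp => //.
  apply: measurable_funD => //; apply: measurable_funM => //.
  by apply: measurable_funX; exact: measurable_funM.
- by apply/measurable_EFinP; exact: measurableT_comp.
- move=> w _; rewrite lee_fin ler_expR; apply: le_trans (H_step _ nN).
  by rewrite /q0 /q1 lerD2l; lra.
Qed.

(** The first-order terms add up to [lam] by [b1]. The rest is quadratic in [lam] with a factor [c]:
    resolvent errors through [<b_n, tail_gram b_n> <= c |b_n|^2], squares through
    [|b_n|^4 <= c |b_n|^2]. Finally [512 L^2 + 2^12 L^4 <= 2^13 L^4]. *)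
Let sum_cst : \sum_(0 <= j < N) cst j <= lam + 2 ^+ 13 * L ^+ 4 * lam ^+ 2 * c.
Proof.
have h n : (n < N)%N -> cst n <= lam * dot (b n) (b n)
    + 512 * L ^+ 2 * lam ^+ 2 * dot (b n) (tail_gram b N n.+1 *m b n)
    + 2 ^+ 12 * L ^+ 4 * lam ^+ 2 * c * dot (b n) (b n).
  move=> nN.
  have h1 := resolvent_diff (tail_gram_sym b N n.+1) kc (tail_gram_ge0 b N n.+1)
    (tail_gram_le bc n.+1) (tail_gram_sqr_le c0 bc n.+1) (b n).
  have L0 : 0 < 256 * L ^+ 2.
    apply: mulr_gt0; first by rewrite ltr0n.
    exact: exprn_gt0 _ (lt_le_trans ltr01 L1).
  have h2 : lam * dot (b n) (invmx (S n.+1) *m b n) - lam * dot (b n) (b n) <=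
     512 * L ^+ 2 * lam ^+ 2 * dot (b n) (tail_gram b N n.+1 *m b n).
    rewrite -(ler_pM2l L0); move: h1; rewrite -/(S n.+1) /k; lra.
  have h3 : (H n.+1 (b n)) ^+ 2 <= 4 * lam ^+ 2 * c * dot (b n) (b n).
    have := H_le n.+1 (b n); move: (H n.+1 (b n)) => x hx.
    rewrite -(real_normK (num_real x)).
    apply: (@le_trans _ _ ((2 * `|lam| * dot (b n) (b n)) ^+ 2)).
      rewrite lerXn2r ?nnegrE// (le_trans _ hx)//.
    rewrite !exprMn real_normK ?num_real//.
    have hc : 0 <= 4 * lam ^+ 2 * dot (b n) (b n).
      by apply: mulr_ge0 (dot_ge0 _); exact: mulr_ge0 (ler0n _ 4) (sqr_ge0 _).
    have := ler_wpM2l hc (b_le nN); lra.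
  rewrite /cst -/(S n.+1).
  have L40 : 0 <= L ^+ 4 by rewrite exprn_even_ge0.
  have := ler_wpM2l L40 h3; move: h2; rewrite -/(H n.+1 (b n)).
  move: (H _ _) => x; lra.
apply: (@le_trans _ _ (\sum_(0 <= n < N) (lam * dot (b n) (b n)
    + 512 * L ^+ 2 * lam ^+ 2 * dot (b n) (tail_gram b N n.+1 *m b n)
    + 2 ^+ 12 * L ^+ 4 * lam ^+ 2 * c * dot (b n) (b n)))).
  by rewrite !big_mkord; apply: ler_sum => n _; exact: h.
rewrite !big_split /= -!mulr_sumr b1 !mulr1.
have h2 : \sum_(0 <= n < N) dot (b n) (tail_gram b N n.+1 *m b n) <= c.
  rewrite -[leRHS]mulr1 -b1 mulr_sumr; apply: ler_sum => n _.
  exact: tail_gram_le.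
have L2 : L ^+ 2 <= L ^+ 4 by apply: ler_weXn2l.
have A0 : 0 <= L ^+ 2 * lam ^+ 2 by rewrite mulr_ge0 ?sqr_ge0.
have B0 : 0 <= lam ^+ 2 * c by rewrite mulr_ge0 ?sqr_ge0// ltW.
have := ler_wpM2l A0 h2; have := ler_wpM2l B0 L2.
have : 0 <= L ^+ 4 * lam ^+ 2 * c.
  by rewrite mulr_ge0 ?(ltW c0)// mulr_ge0 ?sqr_ge0// exprn_even_ge0.
lra.
Qed.

(** At [n = N] the tail is empty, so [H N] is [lam |W|^2]; the centring cancels the term [lam] of
    [sum_cst]. *)
Lemma hanson_wright_mgf :
  (\int[P]_w (expR (lam * (dot (partial_sum N w) (partial_sum N w) - 1)))%:E <=
   (expR (2 ^+ 13 * L ^+ 4 * lam ^+ 2 * c))%:E)%E.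
Proof.
have SN : S N = 1%:M by rewrite /S /tail_gram big_geq// scaler0 subr0.
have mq := H_measurable N.
have -> : (\int[P]_w (expR (lam * (dot (partial_sum N w) (partial_sum N w) - 1)))%:E
   = \int[P]_w ((expR (- lam))%:E * (expR (H N (partial_sum N w)))%:E))%E.
  apply: eq_integral => w _; rewrite -EFinM -expRD /H SN invmx1 mul1mx.
  by congr (expR _)%:E; ring.
rewrite ge0_integralZl//; last first.
  by apply/measurable_EFinP; exact: measurableT_comp.
apply: (@le_trans _ _ ((expR (- lam))%:E * (expR (\sum_(0 <= j < N) cst j))%:E)%E).
  by rewrite lee_wpmul2l ?lee_fin ?expR_ge0//; exact: partial_sum_mgf.
by rewrite -EFinM -expRD lee_fin ler_expR; move: sum_cst; lra.
Qed.

End HansonWright.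

(** * Tail bounds by the Chernoff method, and finite index types *)

Section Tail.
Context {R : realType} d (T : measurableType d) (P : probability T R).

Lemma exp_markov (X : T -> R) (r a : R) : measurable_fun setT X -> 0 < r ->
  (P [set w | (a <= X w)%R] <= (expR (- (r * a)))%:E * \int[P]_w (expR (r * X w))%:E)%E.
Proof.
move=> mX r0; pose X' : {RV P >-> R} := mfun_Sub (mem_set mX).
have := chernoff X' a r0; rewrite /mmt_gen_fun unlock muleC => h.
apply: (le_trans h); rewrite lee_wpmul2l ?lee_fin ?expR_ge0//.
by rewrite le_eqVlt; apply/orP; left; apply/eqP; apply: eq_integral => w _ /=; rewrite mulrC.
Qed.

Lemma hanson_wright_tail m (b : nat -> 'cV[R]_m) (Y : nat -> T -> R) (N : nat)
    (L c rho : R) :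
  1 <= L -> (forall j, measurable_fun setT (Y j)) -> independent_seq P Y N ->
  (forall j, (j < N)%N -> std_subgaussian P L (Y j)) -> 0 < c ->
  (forall y, \sum_(0 <= j < N) dot (b j) y ^+ 2 <= c * dot y y) ->
  \sum_(0 <= j < N) dot (b j) (b j) = 1 -> 0 < rho ->
  let W := partial_sum b Y N in
  (P [set w | (L ^+ 2 * rho <= `|dot (W w) (W w) - 1|)%R] <=
   (2 * expR (- (Num.min rho 1 * rho / (2 ^+ 15 * c))))%:E)%E.
Proof.
move=> L1 mY YN sY c0 bc b1 rho0; set W := partial_sum b Y N; rewrite /=.
have L0 : 0 < L := lt_le_trans ltr01 L1.
have L20 : 0 < L ^+ 2 by rewrite exprn_gt0.
pose mu := Num.min rho 1.
have mu0 : 0 < mu by rewrite lt_min rho0 ltr01.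
have mu1 : mu <= 1 by rewrite ge_min lexx orbT.
have mur : mu <= rho by rewrite ge_min lexx.
have [D DE] : {D : R | D = 2 ^+ 14} by exists (2 ^+ 14).
have D0 : 0 < D by rewrite DE exprn_gt0.
(* Capping [rho] at 1 keeps [lam] admissible for [hanson_wright_mgf]. The exponent becomes
   [- mu rho / (2^14 c) + mu^2 / (2^15 c)], at most [- mu rho / (2^15 c)]. *)
pose lam := mu / (D * (L ^+ 2 * c)).
have Lc0 : 0 < L ^+ 2 * c by rewrite mulr_gt0.
have lam0 : 0 < lam by rewrite divr_gt0// mulr_gt0.
have lamE : lam * (L ^+ 2 * c) = mu / D.
  by rewrite /lam; field; rewrite !gt_eqF.
have mW : measurable_fun setT (fun w => dot (W w) (W w) - 1).
  apply: measurable_funB => //.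
  rewrite (_ : (fun w => _) =
    (fun w => \sum_(i < m) (\sum_(j < N) Y j w * b j i 0) ^+ 2)).
    apply: measurable_sum => i; apply: measurable_funX; apply: measurable_sum => j.
    exact: measurable_funM.
  apply/funext => w; rewrite dotE; apply: eq_bigr => i _; rewrite -expr2.
  congr (_ ^+ 2); rewrite /W /partial_sum big_mkord summxE.
  by apply: eq_bigr => j _; rewrite mxE.
(* The sign [sg] selects the upper or the lower tail. *)
have side sg : `|sg| = 1 ->
  (P [set w | (L ^+ 2 * rho <= sg * (dot (W w) (W w) - 1))%R] <=
   (expR (- (mu * rho / (2 ^+ 15 * c))))%:E)%E.
  move=> sg1.
  have lamb : `|sg * lam| * (1024 * L ^+ 2 * c) <= 1.
    rewrite normrM sg1 mul1r (gtr0_norm lam0).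
    have -> : lam * (1024 * L ^+ 2 * c) = 1024 * (mu / D) by rewrite -lamE; ring.
    rewrite DE; lra.
  have mgf := hanson_wright_mgf L1 mY YN sY c0 bc b1 lamb.
  apply: (le_trans (exp_markov _ _ lam0)).
    exact: measurable_funM.
  apply: (@le_trans _ _ ((expR (- (lam * (L ^+ 2 * rho))))%:E *
     (expR (2 ^+ 13 * L ^+ 4 * (sg * lam) ^+ 2 * c))%:E)%E).
    rewrite lee_wpmul2l ?lee_fin ?expR_ge0//; apply: le_trans mgf.
    rewrite le_eqVlt; apply/orP; left; apply/eqP; apply: eq_integral => w _.
    by congr (expR _)%:E; rewrite mulrA (mulrC lam).
  rewrite -EFinM lee_fin -expRD ler_expR exprMn -(real_normK (num_real sg)) sg1.
  rewrite expr1n mul1r -(ler_pM2r c0).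
  have -> : (- (lam * (L ^+ 2 * rho)) + 2 ^+ 13 * L ^+ 4 * lam ^+ 2 * c) * c =
    - (lam * (L ^+ 2 * c)) * rho + 2 ^+ 13 * (lam * (L ^+ 2 * c)) ^+ 2 by ring.
  rewrite lamE.
  have -> : - (mu * rho / (2 ^+ 15 * c)) * c = - (mu * rho / 2 ^+ 15).
    by field; rewrite gt_eqF.
  rewrite DE; have : mu * mu <= mu * rho by rewrite ler_pM2l.
  move: mu0 => _; lra.
have -> : [set w | L ^+ 2 * rho <= `|dot (W w) (W w) - 1|] =
  [set w | L ^+ 2 * rho <= 1 * (dot (W w) (W w) - 1)] `|`
  [set w | L ^+ 2 * rho <= -1 * (dot (W w) (W w) - 1)].
  by apply/seteqP; split => w /=; rewrite mul1r mulN1r ler_normr => /orP.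
have mset (sg : R) : measurable [set w | L ^+ 2 * rho <= sg * (dot (W w) (W w) - 1)].
  rewrite -[X in measurable X]setTI.
  have h : measurable_fun setT (fun w => sg * (dot (W w) (W w) - 1)).
    exact: measurable_funM.
  exact: (measurable_fun_le measurableT (measurable_cst _) h).
apply: (le_trans (measureU2 _ (mset _) (mset _))).
rewrite (_ : 2 * _ = expR (- (mu * rho / (2 ^+ 15 * c))) + expR (- (mu * rho / (2 ^+ 15 * c)))).
  by rewrite EFinD; apply: leeD; apply: side; rewrite ?normrN normr1.
by rewrite mulr2n mulrDl mul1r.
Qed.

Lemma big_nat_enum_nth (V : nmodType) (J : finType) (j0 : J) (F : J -> V) :
  \sum_(0 <= n < #|J|) F (nth j0 (enum J) n) = \sum_j F j.
Proof. by rewrite -[RHS]big_enum (big_nth j0) -cardE. Qed.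

Definition independent_family (J : finType) (Y : J -> T -> R) :=
  forall E : J -> set R, (forall j, measurable (E j)) ->
  P (\bigcap_j (Y j @^-1` E j)) = (\prod_j P (Y j @^-1` E j))%E.

Lemma independent_family_seq (J : finType) (j0 : J) (Y : J -> T -> R) :
  independent_family Y ->
  independent_seq P (fun n => Y (nth j0 (enum J) n)) #|J|.
Proof.
move=> YJ E mE; have := YJ (fun j => E (index j (enum J))) (fun j => mE _).
rewrite (_ : \bigcap_j _ = \bigcap_(n < #|J|)
    (Y (nth j0 (enum J) n) @^-1` E n)); last first.
  apply/seteqP; split => w h.
    move=> n /= nJ; have := h (nth j0 (enum J) n) I.
    by rewrite /= index_uniq ?enum_uniq// -cardE.
  move=> j _ /=.
  have := h (index j (enum J)).
  by rewrite /= nth_index ?mem_enum// cardE index_mem mem_enum; apply.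
move=> ->; rewrite -big_enum (big_nth j0) -cardE big_mkord.
by apply: eq_bigr => n _; rewrite index_uniq ?enum_uniq// -cardE.
Qed.

Lemma hanson_wright m (J : finType) (b : J -> 'cV[R]_m) (Y : J -> T -> R)
    (L c rho : R) :
  1 <= L -> independent_family Y ->
  (forall j, std_subgaussian P L (Y j)) -> 0 < c ->
  (forall y, \sum_j dot (b j) y ^+ 2 <= c * dot y y) ->
  \sum_j dot (b j) (b j) = 1 -> 0 < rho ->
  let W w := \sum_j Y j w *: b j in
  (P [set w | (L ^+ 2 * rho <= `|dot (W w) (W w) - 1|)%R] <=
   (2 * expR (- (Num.min rho 1 * rho / (2 ^+ 15 * c))))%:E)%E.
Proof.
move=> L1 YJ sY c0 bc b1 rho0; set W := (fun w => \sum_j Y j w *: b j); rewrite /=.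
have [j0 _|J0] := pickP (fun _ : J => true); last first.
  move: b1; rewrite big1 => [/eqP|j _]; first by rewrite eq_sym oner_eq0.
  by have := J0 j.
pose nt n := nth j0 (enum J) n.
have := @hanson_wright_tail m (b \o nt) (Y \o nt) #|J| L c rho L1 _
  (independent_family_seq j0 YJ) _ c0 _ _ rho0.
rewrite (_ : partial_sum _ _ _ = W); last first.
  apply/funext => w; rewrite /partial_sum /W.
  exact: (big_nat_enum_nth j0 (fun j => Y j w *: b j)).
apply.
- by move=> j; case: (sY (nt j)).
- by move=> j _; exact: sY.
- by move=> y; rewrite /= (big_nat_enum_nth j0 (fun j => dot (b j) y ^+ 2)).
- by rewrite /= (big_nat_enum_nth j0 (fun j => dot (b j) (b j))).
Qed.

End Tail.

(** * Nets of the sphere *)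

Section Net.
Context {R : realType}.

Lemma geometric_half_le n : \sum_(i < n) (2^-1 : R) ^+ i <= 2.
Proof.
suff -> : \sum_(i < n) (2^-1 : R) ^+ i = 2 - 2 * 2^-1 ^+ n.
  by rewrite lerBlDr lerDl mulr_ge0// exprn_ge0// invr_ge0.
elim: n => [|n IHn]; first by rewrite big_ord0 expr0; ring.
by rewrite big_ord_recr /= IHn exprS; field.
Qed.

(* Weighting the point [k] by [2 ^- (sum of |k_i|)] makes the total mass a
   product over the coordinates. *)
Lemma card_grid_le d m :
  #|[pred k : {ffun 'I_d -> bool * 'I_m} | (\sum_i (k i).2 <= 16 * d)%N]|%:R
   <= expR (18 * d%:R) :> R.
Proof.
set A := [pred k | _].
(* Each point of [A] weighs at least [2^-(16 d)], while one coordinate has total mass at most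
   [2 + 2 = 4], the boolean being a sign. Hence at most [2^(18 d)] points. *)
have h : #|A|%:R * (2^-1 : R) ^+ (16 * d) <= 4 ^+ d.
  apply: (@le_trans _ _ (\sum_(k in A) \prod_i (2^-1 : R) ^+ (k i).2)).
    rewrite -sum1_card natr_sum mulr_suml; apply: ler_sum => k.
    rewrite inE => kA; rewrite mul1r prodrXr.
    by apply: ler_wiXn2l => //; rewrite ?invr_ge0// invf_le1// ler1n.
  apply: (@le_trans _ _ (\sum_(k : {ffun 'I_d -> bool * 'I_m})
      \prod_i (2^-1 : R) ^+ (k i).2)).
    rewrite [leRHS](bigID (fun k => k \in A))/= lerDl.
    by apply: sumr_ge0 => k _; apply: prodr_ge0 => i _; rewrite exprn_ge0 ?invr_ge0.
  rewrite -(bigA_distr_bigA (fun (_ : 'I_d) (p : bool * 'I_m) => (2^-1 : R) ^+ p.2)).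
  rewrite prodr_const card_ord lerXn2r ?nnegrE//.
    by apply: sumr_ge0 => p _; rewrite exprn_ge0 ?invr_ge0.
  rewrite -(pair_bigA _ (fun (_ : bool) (p : 'I_m) => (2^-1 : R) ^+ p))/=.
  rewrite big_bool; have h := geometric_half_le m; apply: le_trans (lerD h h) _; lra.
have h2 : (2 : R) ^+ (18 * d) <= expR (18 * d%:R).
  rewrite -natrM -[X in expR X]mulr1 expRM_natl lerXn2r ?nnegrE ?expR_ge0//.
  by have := expR_ge1Dx (1 : R).
apply: le_trans h2; move: h; rewrite exprVn ler_pdivrMr ?exprn_gt0//.
by rewrite (_ : (4 : R) = 2 ^+ 2) -?exprM -?exprD -?mulnDl//; ring.
Qed.

(** Round each coordinate towards zero on a grid of mesh [sg = 1 / (4 sqrt d)]: the squared error is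
    at most [d sg^2 = 1 / 16]. The integer magnitudes sum to at most the sum of their squares, hence
    to at most [1 / sg^2 = 16 d]. *)
Lemma quarter_net d : exists s : seq 'cV[R]_d,
  (size s)%:R <= expR (18 * d%:R) :> R /\
  forall u, dot u u = 1 -> exists2 v, v \in s & dot (u - v) (u - v) <= 1 / 16.
Proof.
have [->|d0] := posnP d.
  exists [::]; split; first by rewrite expR_ge0.
  by move=> u; rewrite dotE big_ord0 => /eqP; rewrite eq_sym oner_eq0.
pose sg : R := (4 * Num.sqrt d%:R)^-1.
have sd0 : 0 < Num.sqrt d%:R :> R by rewrite sqrtr_gt0 ltr0n.
have sg0 : 0 < sg by rewrite invr_gt0 mulr_gt0.
have sg2 : sg ^+ 2 * (16 * d%:R) = 1.
  rewrite /sg exprVn exprMn sqr_sqrtr ?ler0n// mulrC.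
  by rewrite (_ : 4 ^+ 2 = 16 :> R) ?divff ?mulf_neq0 ?pnatr_eq0 -?lt0n//; ring.
pose pt (k : {ffun 'I_d -> bool * 'I_(16 * d).+1}) : 'cV[R]_d :=
  \col_i ((-1) ^+ (k i).1 * (k i).2%:R * sg).
exists [seq pt k | k <- enum [pred k : {ffun 'I_d -> bool * 'I_(16 * d).+1} |
   (\sum_i (k i).2 <= 16 * d)%N]].
split; first by rewrite size_map -cardE card_grid_le.
move=> u u1; pose tr i := Num.truncn (`|u i 0| / sg).
have tr_le i : (tr i)%:R <= `|u i 0| / sg.
  by rewrite /tr truncn_le// divr_ge0// ltW.
have tr_gt i : `|u i 0| / sg < (tr i).+1%:R by rewrite /tr truncnS_gt.
have tr_sum : (\sum_i tr i <= 16 * d)%N.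
  rewrite -(ler_nat R) natr_sum natrM.
  apply: (@le_trans _ _ (\sum_i (u i 0 / sg) ^+ 2)).
    apply: ler_sum => i _; apply: (@le_trans _ _ ((tr i)%:R ^+ 2)).
      by rewrite -natrX ler_nat; case: (tr i) => // n; rewrite leq_pmulr.
    rewrite -(real_normK (num_real (u i 0 / sg))) normrM normfV (gtr0_norm sg0).
    by rewrite lerXn2r ?nnegrE ?divr_ge0// ltW.
  under eq_bigr do rewrite exprMn.
  rewrite -mulr_suml -(_ : dot u u = \sum_i u i 0 ^+ 2); last first.
    by rewrite dotE; apply: eq_bigr => i _; rewrite expr2.
  by rewrite u1 mul1r exprVn -(ler_pM2l (exprn_gt0 2 sg0)) sg2 divff// gt_eqF// exprn_gt0.
have tr_lt i : (tr i < (16 * d).+1)%N.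
  by rewrite ltnS (leq_trans _ tr_sum)// (bigD1 i)//= leq_addr.
pose k : {ffun 'I_d -> bool * 'I_(16 * d).+1} :=
  [ffun i => (u i 0 < 0, Ordinal (tr_lt i))].
exists (pt k).
  apply: map_f; rewrite mem_enum inE.
  by under eq_bigr do rewrite ffunE.
rewrite dotE; apply: (@le_trans _ _ (\sum_(i < d) sg ^+ 2)); last first.
  by rewrite sumr_const card_ord -mulr_natr; move: sg2; lra.
apply: ler_sum => i _; rewrite -expr2 !mxE ffunE /=.
rewrite {1}[u i 0]numEsign -mulrA -mulrBr exprMn sqrr_sign mul1r.
have ui0 : 0 <= `|u i 0| := normr_ge0 _.
have := tr_le i; have := tr_gt i.
rewrite ler_pdivlMr// ltr_pdivrMr// -natr1 => h1 h2.
rewrite lerXn2r ?nnegrE ?(ltW sg0)//; lra.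
Qed.

(** Let [m] be the supremum of the form on the sphere and [v = x - a] a net point. Then
    [<x, D x> = <v, D v> + <a, D (2 x - a)>] with [|v|^2 <= 25 / 16], and the cross term is at most
    [9 / 16 m]. So [m <= 25 / 7 tau]. *)
Lemma quadratic_form_net d (D : 'M[R]_d) (s : seq 'cV[R]_d) (tau : R) :
  D^T = D ->
  (forall u, dot u u = 1 -> exists2 v, v \in s & dot (u - v) (u - v) <= 1 / 16) ->
  (forall v, v \in s -> `|dot v (D *m v)| <= tau * dot v v) ->
  forall u, dot u u = 1 -> `|dot u (D *m u)| <= 4 * tau.
Proof.
move=> Dsym net hs u u1.
set A := [set `|dot x (D *m x)| | x in [set x : 'cV[R]_d | dot x x = 1]].
have hA : has_sup A.
  split; first by exists `|dot u (D *m u)|, u.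
  have [C C0 hC] := dot_mulmx_bounded D; exists (1 + C) => _ [x /= x1 <-].
  have := hC x; rewrite x1 mulr1 => hx.
  have := cauchy_schwarz x (D *m x); rewrite x1 mul1r => cs.
  have h0 := sqr_ge0 (`|dot x (D *m x)| - 1).
  have : `|dot x (D *m x)| ^+ 2 <= C by rewrite real_normK ?num_real// (le_trans cs).
  by move: h0; have := normr_ge0 (dot x (D *m x)); lra.
have [_ hu] := hA.
set m := sup A.
have m_ub x : dot x x = 1 -> `|dot x (D *m x)| <= m.
  by move=> x1; apply: (ub_le_sup hu); exists x.
have m0 : 0 <= m by apply: le_trans (m_ub u u1).
have m_ubh x : `|dot x (D *m x)| <= m * dot x x.
  have [->|x0] := eqVneq x 0; first by rewrite mulmx0 dot0r normr0 mulr0.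
  have x1 : 0 < dot x x by rewrite dot_gt0.
  pose y := (enorm x)^-1 *: x.
  have e0 : 0 < enorm x by rewrite enorm_dot sqrtr_gt0.
  have y1 : dot y y = 1.
    by rewrite /y dotZl dotZr -sqr_enorm mulrA -expr2 -exprMn mulVf ?gt_eqF// expr1n.
  have xE : x = enorm x *: y by rewrite /y scalerA divff ?gt_eqF// scale1r.
  move: (enorm x) y e0 y1 xE => e y e0 y1 ->.
  rewrite -scalemxAr !dotZl !dotZr y1 mulr1 mulrA -expr2 normrM ger0_norm ?sqr_ge0//.
  by rewrite [leRHS]mulrC; apply: ler_wpM2l; [exact: sqr_ge0|exact: m_ub].
(* Polarization followed by the parallelogram identity. *)
have pol a b : `|dot a (D *m b)| <= m / 2 * (dot a a + dot b b).
  have e : 4 * dot a (D *m b) =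
      dot (a + b) (D *m (a + b)) - dot (a - b) (D *m (a - b)).
    rewrite mulmxDr mulmxBr !(dotDl, dotDr, dotNl, dotNr).
    have -> : dot b (D *m a) = dot a (D *m b) by rewrite dot_mulmxr Dsym dotC.
    ring.
  have := m_ubh (a + b); have := m_ubh (a - b).
  have -> : dot (a + b) (a + b) = dot a a + 2 * dot a b + dot b b.
    by rewrite !(dotDl, dotDr) (dotC b a); ring.
  have -> : dot (a - b) (a - b) = dot a a - 2 * dot a b + dot b b.
    by rewrite !(dotDl, dotDr, dotNl, dotNr) (dotC b a); ring.
  move: e; move: (dot (a + b) _) (dot (a - b) _) => p q e.
  by rewrite !ler_norml => /andP[h1 h2] /andP[h3 h4]; apply/andP; split; lra.
have step x : dot x x = 1 -> `|dot x (D *m x)| <= 25 / 16 * tau + 9 / 16 * m.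
  move=> x1; have [v vs xv] := net x x1.
  have [a [vE a1]] : exists a, v = x - a /\ dot a a <= 1 / 16.
    by exists (x - v); split => //; rewrite opprB addrC subrK.
  have av := cauchy_schwarz x a; rewrite x1 mul1r in av.
  have xa : `|dot x a| <= 1 / 4.
    rewrite -ler_sqr ?nnegrE//.
    by rewrite real_normK ?num_real//; lra.
  move: xa; rewrite ler_norml => /andP[xa1 xa2].
  have vv : dot v v = 1 - 2 * dot x a + dot a a.
    by rewrite vE !(dotDl, dotDr, dotNl, dotNr) (dotC a x) x1; ring.
  have tau0 : 0 <= tau.
    have := hs v vs; rewrite leNgt => h; rewrite leNgt; apply/negP => t0.
    move: h; apply/negP; rewrite negbK; apply: lt_le_trans (normr_ge0 _).
    have : 0 < dot v v by have := dot_ge0 a; lra.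
    by move=> vv0; rewrite nmulr_rlt0.
  have qv : `|dot v (D *m v)| <= 25 / 16 * tau.
    apply: (le_trans (hs v vs)); rewrite mulrC; apply: ler_wpM2r => //; lra.
  have [c cE] : exists c, c = 2 *: x - a by eexists.
  have cc : dot c c = 4 - 4 * dot x a + dot a a.
    by rewrite cE !(dotDl, dotDr, dotNl, dotNr, dotZl, dotZr) (dotC a x) x1; ring.
  (* The factor 3 balances the two halves: [9 |a|^2 <= 9 / 16], and [|c|^2 / 9 <= 9 / 16] since
     [|c| <= 9 / 4]. *)
  have E : dot x (D *m x) = dot v (D *m v) + dot (3 *: a) (D *m (3^-1 *: c)).
    rewrite -scalemxAr dotZl dotZr mulrA divff// mul1r vE cE !mulmxBr -scalemxAr.
    rewrite !(dotDl, dotDr, dotNl, dotNr, dotZr).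
    have -> : dot a (D *m x) = dot x (D *m a) by rewrite dot_mulmxr Dsym dotC.
    ring.
  rewrite E; apply: (le_trans (ler_normD _ _)); apply: lerD => //.
  apply: (le_trans (pol _ _)).
  rewrite !(dotZl, dotZr) cc.
  have : m * (3 * (3 * dot a a) + 3^-1 * (3^-1 * (4 - 4 * dot x a + dot a a)))
      <= m * (9 / 8) by apply: ler_wpM2l => //; lra.
  lra.
have : m <= 25 / 16 * tau + 9 / 16 * m.
  apply: ge_sup; first by case: hA.
  by move=> _ [x /= x1 <-]; exact: step.
have := m_ub u u1; have := normr_ge0 (dot u (D *m u)); lra.
Qed.

End Net.

(** * Singular values and eigenvectors *)

Section Spectral.
Context {R : realType}.
Import spectral sesquilinear.


(** The complexified matrix is normal, so it is unitarily diagonalizable over [R[i]]; in that basis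
    the form is a sum of eigenvalues weighted by squared moduli. *)
Lemma symmetric_rayleigh_le d (S : 'M[R]_d) (mu : R) : S^T = S ->
  (forall a, root (map_poly (real_complex R) (char_poly S)) a -> mu%:C%C <= a) ->
  forall u, mu * dot u u <= dot u (S *m u).
Proof.
move=> Ssym hmu u; pose phi : {rmorphism R -> R[i]} := real_complex R.
pose SC := map_mx phi S; pose uC := map_mx phi u.
have SCn : SC \is normalmx.
  apply/normalmxP; suff -> : (SC ^t* )%sesqui = SC by [].
  apply/matrixP => i j; rewrite !mxE -[in RHS]Ssym mxE.
  exact: conjc_real.
have [P [D [PU SE]]] : exists P : 'M[R[i]]_d, exists D : 'rV[R[i]]_d,
    P \is unitarymx /\ SC = invmx P *m diag_mx D *m P.
  exists (spectralmx SC), (spectral_diag SC); split.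
    exact: spectral_unitarymx.
  exact/orthomx_spectralP.
have Pu : P \in unitmx := unitarymx_unit PU.
have Dmu i : mu%:C%C <= D 0 i.
  apply: hmu; rewrite map_char_poly -/SC -eigenvalue_root_char.
  apply/eigenvalueP; exists (row i P).
    rewrite -row_mul SE !mulmxA mulmxV// mul1mx row_mul.
    by rewrite row_diag_mx -scalemxAl -rowE.
  apply/eqP => /(congr1 (mulmx^~ (invmx P))); rewrite -row_mul mulmxV// mul0mx.
  move=> /matrixP /(_ 0 i); rewrite !mxE eqxx => /eqP; by rewrite oner_eq0.
pose w := P *m uC.
have wt : (w ^t* )%sesqui = uC^T *m invmx P.
  rewrite (invmx_unitary PU) /w trmx_mul map_mxM; congr (_ *m _).
  by apply/matrixP => i j; rewrite !mxE; exact: conjc_real.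
have e1 : (dot u u)%:C%C = \sum_i `|w i 0| ^+ 2.
  transitivity (((w ^t* )%sesqui *m w) 0 0).
    rewrite wt /w mulmxA mulmxKV// -[LHS](_ : (map_mx phi (u^T *m u)) 0 0 = _).
      by rewrite map_mxM map_trmx.
    by rewrite mxE.
  by rewrite mxE; apply: eq_bigr => i _; rewrite !mxE normCKC.
have e2 : (dot u (S *m u))%:C%C = \sum_i D 0 i * `|w i 0| ^+ 2.
  transitivity (((w ^t* )%sesqui *m (diag_mx D *m w)) 0 0).
    rewrite wt /w -[LHS](_ : (map_mx phi (u^T *m (S *m u))) 0 0 = _).
      by rewrite !map_mxM map_trmx -/SC SE !mulmxA.
    by rewrite mxE.
  rewrite mxE; apply: eq_bigr => i _; rewrite mul_diag_mx !mxE normCKC.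
  by rewrite mulrCA mulrA.
rewrite -lecR rmorphM /= e1 e2 mulr_sumr; apply: ler_sum => i _.
by rewrite ler_wpM2r// exprn_ge0.
Qed.

(** By the factorization in [sv_seq], the complex roots are the squares of the entries of [s], and
    sortedness makes the last entry the least. *)
Lemma sv_seq_last_le d (M : 'M[R]_d) s u : sv_seq M s ->
  (nth 0 s d.-1) ^+ 2 * dot u u <= dot (M *m u) (M *m u).
Proof.
move=> [ss srt s0 cp]; have [d0|d0] := posnP d.
  by rewrite !dotE !big1 ?mulr0 // => i _; have := ltn_ord i; rewrite [X in (_ < X)%N]d0.
rewrite dot_mulmxr mulmxA dotC.
apply: symmetric_rayleigh_le => [|a]; first by rewrite trmx_mul trmxK.
rewrite cp rmorph_prod /= rootE horner_prod prodf_seq_eq0 => /hasP[x xs].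
rewrite /= -rootE rmorphB /= map_polyX map_polyC /= root_XsubC => /eqP ->.
have ge0 y : y \in s -> 0 <= y by move/(allP s0).
rewrite lecR lerXn2r ?nnegrE ?ge0//; first by rewrite mem_nth// ss prednK.
have [j js <-] := nthP 0 xs.
have tr : transitive (fun a b : R => b <= a) by move=> ? ? ? h1 h2; exact: le_trans h2 h1.
apply: (sorted_leq_nth tr _ 0 srt) => //; rewrite ?inE ?ss ?prednK//.
by rewrite -ltnS prednK// -ss.
Qed.

End Spectral.

(** * The data matrix as a linear function of the noise *)

Section Trajectory.
Context {R : realType} (T : Type) (d t : nat) (A : 'M[R]_d).
Implicit Types (eta : nat -> 'I_d -> T -> R) (z : 'cV[R]_d).

(* Coefficient of the noise coordinate [eta p.1.+1 p.2] in [X z]. *)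
Definition noise_coef z (p : 'I_t * 'I_d) : 'cV[R]_t :=
  \col_r (if (p.1 <= r)%N then ((A ^+ (r - p.1))^T *m z) p.2 0 else 0).

(** The unrolled recursion. Counting [j] from 0, the noise [eta j.+1] carries the power
    [s - (j + 1)] of [A]. *)
Lemma traj_sum eta w s :
  traj A eta w s = \sum_(j < s) A ^+ (s.-1 - j) *m \col_i eta j.+1 i w.
Proof.
elim: s => [|s IHs]; first by rewrite big_ord0.
rewrite big_ord_recr /= IHs subnn expr0 -[1]/(1%:M) mul1mx; congr (_ + _).
rewrite mulmx_sumr; apply: eq_bigr => j _; rewrite mulmxA.
case: s j {IHs} => [[]//|s] j /=.
by rewrite mulmxE -exprS subSn// -ltnS.
Qed.

Lemma data_matrix_mul eta w z :
  data_matrix t A eta w *m z = \sum_(p : 'I_t * 'I_d) eta p.1.+1 p.2 w *: noise_coef z p.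
Proof.
apply/colP => r; rewrite summxE mxE.
transitivity (dot z (traj A eta w r.+1)).
  by rewrite dotE; apply: eq_bigr => i _; rewrite !mxE mulrC.
rewrite traj_sum dot_sumr /=.
transitivity (\sum_(j < t) \sum_i
   eta j.+1 i w * (if (j <= r)%N then ((A ^+ (r - j))^T *m z) i 0 else 0)).
  rewrite (big_ord_widen t (fun j => dot z (A ^+ (r - j) *m \col_i eta j.+1 i w)))//.
  rewrite big_mkcond; apply: eq_bigr => j _; rewrite ltnS; case: ifP => jr.
    by rewrite dot_mulmxr dotC dotE; apply: eq_bigr => i _; rewrite !mxE.
  by rewrite big1// => i _; rewrite mulr0.
rewrite pair_bigA /=; apply: eq_bigr => p _; by rewrite !mxE.
Qed.

Lemma dot_mxcol (U V : 'I_t -> 'cV[R]_d) :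
  dot (\mxcol_(r < t) U r) (\mxcol_(r < t) V r) = \sum_r dot (U r) (V r).
Proof. by rewrite /dot tr_mxcol mul_mxrow_mxcol summxE. Qed.

(** The numbers [<b_p, y>] are the entries of the transpose of [bigGamma] applied to the stacked
    vector with blocks [y_r z], whose squared norm is [|z|^2 |y|^2]. *)
Lemma noise_coef_le z y :
  \sum_p dot (noise_coef z p) y ^+ 2 <=
  opnorm (bigGamma t A) ^+ 2 * dot z z * dot y y.
Proof.
pose yz := \mxcol_(r < t) (y r 0 *: z).
have yzE : dot yz yz = dot z z * dot y y.
  rewrite dot_mxcol (dotE y) mulr_sumr; apply: eq_bigr => r _.
  by rewrite dotZl dotZr; ring.
rewrite -mulrA -yzE.
have := dot_trmx_le (sqr_ge0 _) (@dot_mulmx_le _ _ _ (bigGamma t A)) yz.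
apply: le_trans; rewrite le_eqVlt; apply/orP; left; apply/eqP.
rewrite /bigGamma tr_mxblock mul_mxblock_mxrow dot_mxcol.
rewrite -(pair_bigA _ (fun j i => dot (noise_coef z (j, i)) y ^+ 2))/=.
apply: eq_bigr => j _; rewrite dotE; apply: eq_bigr => i _; rewrite -expr2.
congr (_ ^+ 2); rewrite dotE summxE; apply: eq_bigr => r _.
rewrite -scalemxAr [RHS]mxE [X in X * _]mxE mulrC /=; congr (_ * _).
by case: ifP => // _; rewrite trmx0 mul0mx mxE.
Qed.

(** Row [r] collects [|(A^(r - j))^T z|^2] over [j <= r]; reversing the order of the lags turns this
    into the form of [Gram_s A r]. *)
Lemma noise_coef_norm z :
  \sum_p dot (noise_coef z p) (noise_coef z p) =
  dot z ((\sum_(s < t) Gram_s A s) *m z).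
Proof.
rewrite mulmx_suml dot_sumr.
transitivity (\sum_p \sum_r noise_coef z p r 0 ^+ 2).
  by apply: eq_bigr => p _; rewrite dotE; apply: eq_bigr => r _; rewrite expr2.
rewrite exchange_big /=; apply: eq_bigr => r _.
rewrite /Gram_s mulmx_suml dot_sumr.
have F k : dot z (A ^+ k *m (A ^+ k)^T *m z) =
    \sum_i (((A ^+ k)^T *m z) i 0) ^+ 2.
  rewrite -mulmxA dot_mulmxr dotE; apply: eq_bigr => i _; by rewrite expr2.
under [RHS]eq_bigr do rewrite F.
rewrite (reindex_inj rev_ord_inj) /=.
rewrite (big_ord_widen t (fun k => \sum_i (((A ^+ (r.+1 - k.+1))^T *m z) i 0) ^+ 2))//.
rewrite -(pair_bigA _ (fun j i => noise_coef z (j, i) r 0 ^+ 2))/=.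
rewrite [RHS]big_mkcond; apply: eq_bigr => j _; rewrite ltnS subSS.
case: ifP => jr; first by apply: eq_bigr => i _; rewrite [noise_coef _ _ _ _]mxE /= jr.
by rewrite big1// => i _; rewrite [noise_coef _ _ _ _]mxE /= jr expr0n.
Qed.

End Trajectory.

(** * From near-isometry of [X M] to singular values of [X] *)

Section SingularValues.
Context {R : realType}.

Lemma sv_seq_eigenvector m n (W : 'M[R]_(m, n)) s a : sv_seq W s -> a \in s ->
  exists2 x : 'cV[R]_n, x != 0 & W^T *m W *m x = a ^+ 2 *: x.
Proof.
move=> [_ _ _ cp] as_.
have : eigenvalue (W^T *m W) (a ^+ 2).
  rewrite eigenvalue_root_char cp rootE horner_prod prodf_seq_eq0.
  by apply/hasP; exists a => //=; rewrite hornerXsubC subrr.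
move=> /eigenvalueP[v vE v0]; exists v^T.
  by apply: contra_neq v0 => v0; rewrite -[v]trmxK v0 trmx0.
have := congr1 trmx vE; rewrite trmx_mul trmx_mul trmxK linearZ /=.
by move=> <-.
Qed.

(** The maximum of [a] and [a^2] is calibrated to both sides: [1 + a + a^2 <= (1 + a)^2], and
    [1 - a >= (1 - a)^2] for [a <= 1], while for [a > 1] the lower bound is negative. *)
Lemma sqr_deviation (y a : R) : 0 <= y -> 0 <= a ->
  `|y ^+ 2 - 1| <= Num.max a (a ^+ 2) -> 1 - a <= y /\ y <= 1 + a.
Proof.
move=> y0 a0; rewrite ler_norml => /andP[h1 h2]; split.
  have [a1|a1] := leP 1 a; first by lra.
  have e : Num.max a (a ^+ 2) = a by apply/max_idPl; rewrite ler_piMl// ltW.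
  rewrite e in h1; have h : (1 - a) ^+ 2 <= y ^+ 2.
    have : a * a <= a by rewrite ler_piMl// ltW.
    lra.
  by rewrite -ler_sqr ?nnegrE//; lra.
have h : Num.max a (a ^+ 2) <= a + a ^+ 2.
  by rewrite ge_max lerDl lerDr sqr_ge0 a0.
rewrite -ler_sqr ?nnegrE//; last by lra.
lra.
Qed.

(** Take an eigenvector [v] of [X^T X] for the given singular value [x], and let [u] be the
    direction of [M^-1 v]. Then [|X M u| = x |M u|] and [s_d(M) <= |M u| <= opnorm M], so one vector
    gives both bounds. *)
Lemma singular_values_bounds t d (X : 'M[R]_(t, d)) (M : 'M[R]_d) a sX sM :
  M \in unitmx -> 0 <= a ->
  (forall u, dot u u = 1 ->
     `|dot (X *m M *m u) (X *m M *m u) - 1| <= Num.max a (a ^+ 2)) ->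
  sv_seq X sX -> sv_seq M sM ->
  forall k, (k < d)%N ->
    (opnorm M)^-1 * (1 - a) <= nth 0 sX k /\ nth 0 sX k <= (1 + a) / nth 0 sM d.-1.
Proof.
move=> uM a0 hX svX svM k kd.
have [sXs _ sX0 _] := svX; have [sMs _ sM0 _] := svM.
have kX : nth 0 sX k \in sX by rewrite mem_nth// sXs.
have x0 := allP sX0 _ kX.
set x := nth 0 sX k in kX x0 *.
have d0 : (0 < d)%N by apply: leq_ltn_trans kd.
have lM : nth 0 sM d.-1 \in sM by rewrite mem_nth// sMs prednK.
have y0 := allP sM0 _ lM.
set y := nth 0 sM d.-1 in lM y0 *.
have [v v0 vE] := sv_seq_eigenvector svX kX.
pose u0 := invmx M *m v.
have u00 : u0 != 0.
  apply: contra_neq v0 => u00; have := congr1 (mulmx M) u00.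
  by rewrite /u0 mulKVmx// mulmx0.
have e0 : 0 < enorm u0 by rewrite enorm_dot sqrtr_gt0 dot_gt0.
pose u := (enorm u0)^-1 *: u0.
have u1 : dot u u = 1.
  by rewrite /u dotZl dotZr -sqr_enorm mulrA -expr2 -exprMn mulVf ?gt_eqF// expr1n.
have Mu : X^T *m X *m (M *m u) = x ^+ 2 *: (M *m u).
  by rewrite /u -!scalemxAr /u0 mulKVmx// vE scalerA mulrC -scalerA.
have Xu : dot (X *m M *m u) (X *m M *m u) = (x * enorm (M *m u)) ^+ 2.
  rewrite -mulmxA (dot_mulmxr X) mulmxA Mu dotZl exprMn sqr_enorm.
  by [].
have xM0 : 0 <= x * enorm (M *m u) by rewrite mulr_ge0 ?enorm_ge0.
have [h1 h2] := sqr_deviation xM0 a0 (ltac:(by rewrite -Xu; exact: hX)).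
have n1 : enorm (M *m u) <= opnorm M.
  by apply: le_trans (enorm_mulmx _ _) _; rewrite enorm_dot u1 sqrtr1 mulr1.
have n2 : y <= enorm (M *m u).
  rewrite -ler_sqr ?nnegrE ?enorm_ge0// sqr_enorm.
  by have := sv_seq_last_le u svM; rewrite u1 mulr1.
(* A vanishing [s_d(M)] would produce a nonzero kernel vector of the invertible [M]. *)
have y1 : 0 < y.
  rewrite lt_def y0 andbT; apply/negP => /eqP yE.
  have [z z0] := sv_seq_eigenvector svM lM; rewrite yE expr0n scale0r -mulmxA.
  move=> /(congr1 (dot z)); rewrite dot_mulmxr trmxK dot0r => /eqP.
  rewrite dot_eq0 => /eqP Mz; case/eqP: z0.
  by rewrite -(mulKmx uM z) Mz mulmx0.
have o0 : 0 < opnorm M by apply: lt_le_trans y1 (le_trans n2 n1).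
split.
  rewrite mulrC ler_pdivrMr//; apply: (le_trans h1); exact: ler_wpM2l.
by rewrite ler_pdivlMr//; apply: le_trans h2; exact: ler_wpM2l.
Qed.

End SingularValues.

(** * The noise process *)

Section Noise.
Context {R : realType} dsp (T : measurableType dsp) (P : probability T R).

(** Integrating [1 + Y^2 / k^2 <= exp (Y^2 / k^2)] gives [1 + k^-2 <= 2], hence [K >= 1]. The level
    [2 K] lies strictly above the infimum, so some admissible [k] lies below it. *)
Lemma psi2norm_unit_variance (Y : T -> R) K : measurable_fun setT Y ->
  (\int[P]_w (Y w ^+ 2)%:E = 1)%E -> (psi2norm P Y <= K%:E)%E ->
  1 <= K /\ (\int[P]_w (expR (Y w ^+ 2 / (2 * K) ^+ 2))%:E <= 2%:E)%E.
Proof.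
move=> mY Y2 YK.
have mE (k : R) : measurable_fun setT (fun w => expR (Y w ^+ 2 / k ^+ 2)).
  apply: measurableT_comp => //; apply: measurable_funM => //.
  exact: measurable_funX.
have ge1 k : 0 < k -> (\int[P]_w (expR (Y w ^+ 2 / k ^+ 2))%:E <= 2%:E)%E ->
    1 <= k.
  move=> k0 hk.
  have h : (\int[P]_w ((1%:E + (k ^- 2)%:E * (Y w ^+ 2)%:E)) <= 2%:E)%E.
    apply: le_trans hk; apply: ge0_le_integral => //.
    - by move=> w _; rewrite -EFinM -EFinD lee_fin addr_ge0// mulr_ge0 ?sqr_ge0
        ?invr_ge0 ?sqr_ge0.
    - apply/measurable_EFinP; apply: measurable_funD => //.
      by apply: measurable_funM => //; exact: measurable_funX.
    - exact/measurable_EFinP.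
    - by move=> w _; rewrite -EFinM -EFinD lee_fin mulrC expR_ge1Dx.
  have k2 : (0 <= (k ^- 2)%:E)%E by rewrite lee_fin invr_ge0 sqr_ge0.
  move: h; rewrite ge0_integralD//; last 2 first.
  - by move=> w _; rewrite -EFinM lee_fin mulr_ge0 ?sqr_ge0 ?invr_ge0 ?sqr_ge0.
  - apply/measurable_EFinP; apply: measurable_funM => //; exact: measurable_funX.
  rewrite ge0_integralZl//; last 2 first.
  - by apply/measurable_EFinP; exact: measurable_funX.
  - by move=> w _; rewrite lee_fin sqr_ge0.
  rewrite Y2 mule1 integral_cst// [X in (_ * X)%E](_ : _ = 1%E); last exact: probability_setT.
  rewrite mule1 -EFinD lee_fin => h.
  have : k ^- 2 <= 1 by lra.
  rewrite invf_le1 ?exprn_gt0// => h1.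
  by rewrite -(@expr_ge1 _ 2)// ltW.
have K1 : 1 <= K.
  rewrite -lee_fin; apply: le_trans YK; apply: le_ereal_inf_tmp => _ [k [k0 hk] <-].
  by rewrite lee_fin ge1.
split=> //.
have : (psi2norm P Y < (2 * K)%:E)%E.
  by apply: (le_lt_trans YK); rewrite lte_fin; lra.
move=> /ereal_inf_lt [_ [k [k0 hk] <-]]; rewrite lte_fin => kK.
apply: le_trans hk; apply: ge0_le_integral => //.
- exact/measurable_EFinP.
- exact/measurable_EFinP.
move=> w _; rewrite lee_fin ler_expR ler_wpM2l ?sqr_ge0//.
by rewrite lef_pV2 ?posrE ?exprn_gt0 ?lerXn2r ?nnegrE ?ltW//; lra.
Qed.

Lemma noise_independent d t (eta : nat -> 'I_d -> {RV P >-> R}) :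
  mutually_independent P [set s | (1 <= s)%N]
    (fun s => sigmaRVec (fun i => eta s i)) ->
  (forall s, (1 <= s)%N ->
    mutually_independent P [set: 'I_d] (fun i => sigmaRV (eta s i))) ->
  independent_family P (fun p : 'I_t * 'I_d => eta p.1.+1 p.2 : T -> R).
Proof.
move=> Ivec Icoord E mE.
(* Time starts at 1 and ['I_t] at 0, so [s.-1] undoes the shift; times beyond [t] receive the whole
   line. *)
pose e s i : set R := if insub s.-1 is Some j then E (j, i) else setT.
have eE (j : 'I_t) i : e j.+1 i = E (j, i) by rewrite /e /= valK.
have me s i : measurable (e s i).
  by rewrite /e; case: insub => [j|]; [exact: mE|exact: measurableT].
pose F s : set T := \bigcap_(i in [set` enum 'I_d]) (eta s i @^-1` e s i).
have PF s : (1 <= s)%N -> P (F s) = (\prod_i P (eta s i @^-1` e s i))%E.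
  move=> s1; rewrite /F (Icoord s s1) ?enum_uniq//.
    by rewrite big_enum.
  by move=> i _; split => //; exists (e s i) => //; rewrite setTI.
pose J := [seq (val j).+1 | j <- enum 'I_t].
have JF : P (\bigcap_(s in [set` J]) F s) = (\prod_(s <- J) P (F s))%E.
  apply: Ivec.
    by rewrite map_inj_uniq ?enum_uniq// => i j [] /val_inj.
  move=> _ /mapP[j _ ->]; split => //; rewrite /F.
  pose G := \bigcup_(i in [set: 'I_d]) sigmaRV (eta (val j).+1 i).
  apply: (@fin_bigcap_measurable _ (g_sigma_algebraType G)).
    exact: finite_finpred.
  move=> i _; apply: sub_sigma_algebra; exists i => //.
  by exists (e (val j).+1 i) => //; rewrite setTI.
transitivity (P (\bigcap_(s in [set` J]) F s)).
  congr (P _); apply/seteqP; split => w h.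
    move=> _ /= /mapP[j _ ->] i _ /=; rewrite eE; exact: (h (j, i)).
  move=> [j i] _ /=; rewrite -eE.
  by apply: (h (val j).+1) => /=; [apply/mapP; exists j; rewrite ?mem_enum|rewrite mem_enum].
rewrite JF /J big_map big_enum /=.
rewrite [RHS](eq_bigr (fun p : 'I_t * 'I_d => P (eta p.1.+1 p.2 @^-1` E (p.1, p.2))));
  last first.
  by case.
rewrite -(pair_bigA _ (fun (j : 'I_t) i => P (eta j.+1 i @^-1` E (j, i))))/=.
by apply: eq_bigr => j _; rewrite PF//; apply: eq_bigr => i _; rewrite eE.
Qed.


Lemma measure_bigsetU_le (I : eqType) (s : seq I) (B : I -> set T) (x : \bar R) :
  (forall i, measurable (B i)) -> (forall i, P (B i) <= x)%E ->
  (P (\big[setU/set0]_(i <- s) B i) <= (size s)%:R%:E * x)%E.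
Proof.
move=> mB hB; elim: s => [|i s IHs]; first by rewrite big_nil measure0 mul0e.
have x0 : (0 <= x)%E by apply: le_trans (hB i).
rewrite big_cons; apply: le_trans (measureU2 _ (mB i) _) _.
  exact: bigsetU_measurable.
rewrite /= -natr1 EFinD ge0_muleDl ?lee_fin// mul1e addeC.
by apply: leeD.
Qed.

Lemma dot_sum_measurable m (J : finType) (Y : J -> T -> R) (b : J -> 'cV[R]_m) :
  (forall j, measurable_fun setT (Y j)) ->
  measurable_fun setT
    (fun w => dot (\sum_j Y j w *: b j) (\sum_j Y j w *: b j)).
Proof.
move=> mY; rewrite (_ : (fun w => _) =
    (fun w => \sum_(i < m) (\sum_j Y j w * b j i 0) ^+ 2)).
  apply: measurable_sum => i; apply: measurable_funX; apply: measurable_sum => j.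
  exact: measurable_funM.
apply/funext => w; rewrite dotE; apply: eq_bigr => i _; rewrite -expr2 summxE.
by congr (_ ^+ 2); apply: eq_bigr => j _; rewrite mxE.
Qed.

End Noise.

(** As [K >= 1], both [eps] and [eps^2] are at most [16 rho]: the first serves when [rho <= 1], the
    second when [rho > 1]. *)
Lemma sqr_le_min_max {R : realType} (eps K : R) : 0 < eps -> 1 <= K ->
  let rho := Num.max eps (K ^+ 2 * eps ^+ 2) / 16 in
  eps ^+ 2 / 2 ^+ 8 <= Num.min rho 1 * rho.
Proof.
move=> e0 K1 /=; set rho := _ / 16.
have h1 : eps <= 16 * rho by rewrite /rho mulrC mulfVK// le_max lexx.
have h2 : eps ^+ 2 <= 16 * rho.
  rewrite /rho mulrC mulfVK// le_max; apply/orP; right.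
  by rewrite ler_peMl ?sqr_ge0// expr_ge1//; lra.
have h3 : eps ^+ 2 <= (16 * rho) ^+ 2 by rewrite lerXn2r ?nnegrE//; lra.
have [r1|r1] := leP rho 1; lra.
Qed.

(** * Choice of constants and union bound over the net *)

Theorem theorem2 (R : realType) :
  exists c1 c2 : R, 0 < c1 /\ 0 < c2 /\
  forall (d : nat) (A : 'M[R]_d)
         (dsp : measure_display) (T : measurableType dsp) (P : probability T R)
         (eta : nat -> 'I_d -> {RV P >-> R}) (K : R) (t : nat) (eps : R)
         (M : 'M[R]_d),
    spectral_radius A < 1 ->
    (* (eta_s)_{s >= 1}: independent random vectors *)
    mutually_independent P [set s | (1 <= s)%N]
      (fun s => sigmaRVec (fun i => eta s i)) ->
    (* identically distributed *)
    (forall s, (1 <= s)%N -> forall B, borelRd B ->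
       P (rvec (fun i => eta s i) @^-1` B) = P (rvec (fun i => eta 1%N i) @^-1` B)) ->
    (* zero mean *)
    (forall s i, (1 <= s)%N -> (\int[P]_w (eta s i w)%:E = 0)%E) ->
    (* isotropic: E[eta eta^T] = I_d *)
    (forall s i j, (1 <= s)%N ->
       (\int[P]_w (eta s i w * eta s j w)%:E = ((i == j)%:R)%:E)%E) ->
    (* independent coordinates *)
    (forall s, (1 <= s)%N ->
       mutually_independent P [set: 'I_d] (fun i => sigmaRV (eta s i))) ->
    (* coordinates of psi_2-norm at most K *)
    (forall s i, (1 <= s)%N -> (psi2norm P (eta s i) <= K%:E)%E) ->
    (1 <= t)%N ->
    (* M = (sum_{s=0}^{t-1} Gamma_s(A))^{-1/2} *)
    inv_sqrt_of (\sum_(s < t) Gram_s A s) M ->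
    0 < eps ->
    exists E : set T, measurable E /\
      ((1 - 2 * expR (- c1 * eps ^+ 2 /
              (opnorm M ^+ 2 * opnorm (bigGamma t A) ^+ 2) + c2 * d%:R))%:E
         <= P E)%E /\
      forall w, E w ->
        forall sX sM : seq R,
          sv_seq (data_matrix t A (fun s i => eta s i) w) sX ->
          sv_seq M sM ->
          forall k, (k < d)%N ->
            (opnorm M)^-1 * (1 - K ^+ 2 * eps) <= nth 0 sX k /\
            nth 0 sX k <= (1 + K ^+ 2 * eps) / nth 0 sM d.-1.
Proof.
(* [2^-23] is [2^-15] from Hanson-Wright times [2^-8] from [sqr_le_min_max]; [18] is the exponent of
   the net size. *)
exists (2 ^- 23), 18; split; first by rewrite invr_gt0 exprn_gt0.
split; first by rewrite ltr0n.
move=> d A dsp T P eta K t eps M _ Ivec _ mean0 isot Icoord psi t1 [Msym _ MMS] eps0.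
have [d0|d0] := posnP d.
  exists setT; split => //; split; last first.
    by move=> w _ sX sM _ _ k kd; have := leq_ltn_trans (leq0n k) kd;
      rewrite [X in (_ < X)%N]d0.
  rewrite [leRHS](_ : _ = 1%E); last exact: probability_setT.
  by rewrite lee_fin gerBl mulr_ge0 ?expR_ge0.
have var1 s i : (1 <= s)%N -> (\int[P]_w (eta s i w ^+ 2)%:E = 1)%E.
  move=> s1; have := isot s i i s1; rewrite eqxx => <-.
  by apply: eq_integral => w _; rewrite expr2.
have psiK s i (s1 : (1 <= s)%N) :=
  psi2norm_unit_variance (measurable_funP (eta s i)) (var1 s i s1) (psi s i s1).
have K1 : 1 <= K by have [] := psiK 1%N (Ordinal d0) isT.
have sY (p : 'I_t * 'I_d) : std_subgaussian P (2 * K) (eta p.1.+1 p.2).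
  split; [exact: measurable_funP|exact: mean0|exact: var1|].
  by have [] := psiK p.1.+1 p.2 isT.
have L1 : 1 <= 2 * K by lra.
have uM : M \in unitmx by rewrite -mulmxA in MMS; have [] := mulmx1_unit MMS.
have MSM : M *m (\sum_(s < t) Gram_s A s) *m M = 1%:M.
  by rewrite -mulmxA in MMS; exact: mulmx1C.
set c := opnorm M ^+ 2 * opnorm (bigGamma t A) ^+ 2.
have coef1 u : dot u u = 1 ->
    \sum_p dot (noise_coef A (M *m u) p) (noise_coef (t := t) A (M *m u) p) = 1.
  by move=> u1; rewrite noise_coef_norm -{1}Msym -dot_mulmxr !mulmxA MSM mul1mx.
have coefc u y : dot u u = 1 ->
    \sum_p dot (noise_coef (t := t) A (M *m u) p) y ^+ 2 <= c * dot y y.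
  move=> u1; apply: le_trans (noise_coef_le _ _ _) _.
  rewrite ler_wpM2r ?dot_ge0// /c mulrC ler_wpM2r ?sqr_ge0//.
  by have := dot_mulmx_le M u; rewrite u1 mulr1.
have c_ge0 : 0 <= c by rewrite mulr_ge0 ?sqr_ge0.
(* If [c] vanished, [coefc] would make every coefficient zero, against [coef1]. *)
have c0 : 0 < c.
  rewrite lt_def c_ge0 andbT; apply/negP => /eqP cE.
  pose u : 'cV[R]_d := delta_mx (Ordinal d0) 0.
  have u1 : dot u u = 1.
    by rewrite /dot trmx_delta mul_delta_mx mxE !eqxx.
  have := coef1 u u1; rewrite big1 => [/eqP|p _]; first by rewrite eq_sym oner_eq0.
  apply/eqP; rewrite -sqrf_eq0 eq_le sqr_ge0 andbT.
  have := coefc u (noise_coef A (M *m u) p) u1; rewrite cE mul0r; apply: le_trans.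
  by rewrite (bigD1 p)//= lerDl sumr_ge0// => q _; exact: sqr_ge0.
pose X w := data_matrix t A (fun s i => eta s i) w.
(* With [L = 2 K] and the factor 4 lost on the net, [4 tau] is the maximum of [a] and [a^2] for
   [a = K^2 eps]; this explains the 16. *)
pose rho := Num.max eps (K ^+ 2 * eps ^+ 2) / 16.
pose tau := (2 * K) ^+ 2 * rho.
have rho0 : 0 < rho by rewrite divr_gt0// lt_max eps0.
pose bad u := [set w | tau <= `|dot (X w *m (M *m u)) (X w *m (M *m u)) - 1|].
have badE u : bad u = [set w | tau <= `|dot
    (\sum_(p : 'I_t * 'I_d) (eta p.1.+1 p.2 w) *: noise_coef A (M *m u) p)
    (\sum_(p : 'I_t * 'I_d) (eta p.1.+1 p.2 w) *: noise_coef A (M *m u) p) - 1|].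
  by apply/seteqP; split => w; rewrite /bad /= data_matrix_mul.
have Pbad u : dot u u = 1 ->
    (P (bad u) <= (2 * expR (- (2 ^- 23 * eps ^+ 2 / c)))%:E)%E.
  move=> u1; rewrite badE.
  apply: le_trans (hanson_wright L1 (noise_independent Ivec Icoord) sY c0
    (fun y => coefc u y u1) (coef1 u u1) rho0) _.
  rewrite lee_fin ler_pM2l// ler_expR lerN2.
  have -> : 2 ^- 23 * eps ^+ 2 / c = eps ^+ 2 / 2 ^+ 8 / (2 ^+ 15 * c).
    by field; rewrite gt_eqF.
  rewrite ler_pM2r; first exact: (sqr_le_min_max eps0 K1).
  by rewrite invr_gt0 mulr_gt0// exprn_gt0.
have mbad u : measurable (bad u).
  rewrite badE -[X in measurable X]setTI.
  apply: (measurable_fun_le measurableT (measurable_cst _)).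
  apply: measurableT_comp => //; apply: measurable_funB => //.
  by apply: dot_sum_measurable => p; exact: measurable_funP.
have [s [ss net]] := quarter_net (R := R) d.
(* Net points need not be unit vectors, so Hanson-Wright is applied to their directions; a zero net
   point gets the empty event. *)
pose dir (v : 'cV[R]_d) := (enorm v)^-1 *: v.
have dir1 v : v != 0 -> dot (dir v) (dir v) = 1.
  move=> v0; have e0 : 0 < enorm v by rewrite enorm_dot sqrtr_gt0 dot_gt0.
  by rewrite /dir dotZl dotZr -sqr_enorm mulrA -expr2 -exprMn mulVf ?gt_eqF// expr1n.
pose B v := if v == 0 then set0 else bad (dir v).
have mB v : measurable (B v) by rewrite /B; case: ifP.
set p := expR (- (2 ^- 23 * eps ^+ 2 / c)) in Pbad.
have PB v : (P (B v) <= (2 * p)%:E)%E.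
  rewrite /B; case: eqVneq => [_|v0]; last by apply: Pbad; exact: dir1.
  by rewrite measure0 lee_fin mulr_ge0// expR_ge0.
pose U := \big[setU/set0]_(v <- s) B v.
have mU : measurable U by exact: bigsetU_measurable.
exists (~` U); split; first exact: measurableC.
split.
  rewrite probability_setC// EFinB; apply: leeB => //.
  apply: le_trans (measure_bigsetU_le s mB PB) _.
  rewrite -EFinM lee_fin mulrCA ler_pM2l// addrC expRD.
  rewrite (_ : - 2 ^- 23 * eps ^+ 2 / c = - (2 ^- 23 * eps ^+ 2 / c)); last by ring.
  by rewrite -/p ler_wpM2r ?expR_ge0.
move=> w Uw sX sM svX svM.
apply: (singular_values_bounds uM _ _ svX svM).
  by rewrite mulr_ge0 ?sqr_ge0 ?ltW.
(* The form of [D] measures the deviation of [X M] from an isometry, and homogeneity carries the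
   bound from [dir v] back to [v]. *)
pose D := (X w *m M)^T *m (X w *m M) - 1%:M.
have DE v : dot v (D *m v) = dot (X w *m M *m v) (X w *m M *m v) - dot v v.
  by rewrite /D mulmxBl mul1mx dotDr dotNr -(mulmxA _^T)
    (dot_mulmxr _^T) trmxK.
have Dsym : D^T = D by rewrite /D linearB /= trmx_mul trmxK trmx1.
have hs v : v \in s -> `|dot v (D *m v)| <= tau * dot v v.
  move=> vs; rewrite DE.
  have [->|v0] := eqVneq v 0; first by rewrite mulmx0 !dot0r subrr normr0 mulr0.
  have nb : ~ bad (dir v) w.
    move=> bw; apply: Uw; rewrite /U -bigcup_seq; exists v => //.
    by rewrite /B (negbTE v0).
  have e0 : 0 < enorm v by rewrite enorm_dot sqrtr_gt0 dot_gt0.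
  have vE : v = enorm v *: dir v by rewrite /dir scalerA divff ?gt_eqF// scale1r.
  have d1 := dir1 v v0.
  move: (enorm v) (dir v) e0 vE d1 nb => e u e0 -> u1 /negP nb.
  rewrite -!scalemxAr !dotZl !dotZr u1 !mulr1.
  have -> q : e * (e * q) - e * e = e * e * (q - 1) by ring.
  have ee0 : 0 <= e * e by rewrite mulr_ge0 ?ltW.
  rewrite normrM (ger0_norm ee0) mulrC; apply: ler_wpM2r => //.
  by move: nb; rewrite /bad /= -ltNge mulmxA => /ltW.
move=> u u1; have := quadratic_form_net Dsym net hs u1.
rewrite DE u1 => h; apply: (le_trans h); rewrite /tau /rho.
have -> : 4 * ((2 * K) ^+ 2 * (Num.max eps (K ^+ 2 * eps ^+ 2) / 16)) =
    K ^+ 2 * Num.max eps (K ^+ 2 * eps ^+ 2) by field.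
rewrite maxr_pMr ?sqr_ge0//.
by have -> : (K ^+ 2 * eps) ^+ 2 = K ^+ 2 * (K ^+ 2 * eps ^+ 2) by ring.
Qed.
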